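(* There is an absolute constant $c_2 > 0$ such that, for all $n \in \mathbb{N}$, with $N := 2^n = \deg(P_n)+1$, and for all $\alpha,\beta \in \mathbb{R}$ such that $$\frac{32\pi}{N} \leq \frac{(\log N)^{3/2}}{N^{1/2}} \leq \beta-\alpha \leq 2\pi\,,$$ the $n$-th Rudin-Shapiro polynomials $P_n$ and $Q_n$ satisfy $$M_0(P_n,[\alpha,\beta]) \geq c_2\sqrt{N} \qquad\text{and}\qquad M_0(Q_n,[\alpha,\beta]) \geq c_2\sqrt{N}\,.$$
   Context: The Rudin-Shapiro polynomials are defined recursively by $P_0(z) := 1$, $Q_0(z) := 1$, and $$P_{n+1}(z) := P_n(z) + z^{2^n}Q_n(z)\,, \qquad Q_{n+1}(z) := P_n(z) - z^{2^n}Q_n(z)\,, \qquad n=0,1,2,\ldots.$$ For real numbers $\alpha<\beta$ and a polynomial $Q$ (not identically zero), the Mahler measure on $[\alpha,\beta]$ is $$M_0(Q,[\alpha,\beta]) := \exp\left(\frac{1}{\beta-\alpha}\int_\alpha^\beta \log|Q(e^{it})|\,dt\right).$$ Here $\log$ is the natural logarithm. *)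

(* Defs.v *)
From mathcomp Require Import all_boot all_order all_algebra.
From mathcomp Require Import complex.
From mathcomp Require Import all_classical all_reals all_analysis.

Set Implicit Arguments.
Unset Strict Implicit.
Unset Printing Implicit Defensive.

Import Order.TTheory GRing.Theory Num.Theory.
Import numFieldNormedType.Exports.

Local Open Scope classical_set_scope.
Local Open Scope complex_scope.
Local Open Scope ring_scope.

Fixpoint rudin_shapiroP (K : nzRingType) (n : nat) : {poly K} :=
  if n is m.+1 then rudin_shapiroP K m + 'X^(2 ^ m) * rudin_shapiroQ K m
  else 1
with rudin_shapiroQ (K : nzRingType) (n : nat) : {poly K} :=
  if n is m.+1 then rudin_shapiroP K m - 'X^(2 ^ m) * rudin_shapiroQ K m
  else 1.

Lemma size_rudin_shapiro (K : nzRingType) (n : nat) :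
  size (rudin_shapiroP K n) = (2 ^ n)%N /\ size (rudin_shapiroQ K n) = (2 ^ n)%N.
Proof.
elim: n => [|n [sP sQ]] /=; first by rewrite !size_poly1.
have Q0 : rudin_shapiroQ K n != 0 by rewrite -size_poly_gt0 sQ expn_gt0.
have sXQ : size ('X^(2 ^ n) * rudin_shapiroQ K n) = (2 ^ n.+1)%N.
  by rewrite -commr_polyXn size_mulXn // sQ addnn -mul2n expnS.
have lt : (size (rudin_shapiroP K n) < 2 ^ n.+1)%N by rewrite sP ltn_exp2l.
by split; rewrite addrC size_polyDl ?size_polyN ?sXQ.
Qed.

Definition cis (R : realType) (t : R) : R[i] := cos t +i* sin t.

(* The modulus is taken with values in R ([normc]), the norm of [R[i]] having
   values in [R[i]].  The logarithm, the (Lebesgue) integral and the exponential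
   are those of the extended reals, with lne 0 = -oo and expeR -oo = 0, so that
   the zeros of [Q] on the unit circle need no convention. *)
Definition mahler_measure (R : realType) (Q : {poly R[i]}) (a b : R) : \bar R :=
  expeR (((b - a)^-1)%:E *
    \int[lebesgue_measure]_(t in `[a, b])
      lne (ComplexField.Normc.normc Q.[cis t])%:E)%E.

(* Main.v *)
Require Import Defs.
From mathcomp Require Import all_boot all_order all_algebra.
From mathcomp Require Import complex.
From mathcomp Require Import all_classical all_reals all_analysis.
From mathcomp Require Import measurable_realfun ring lra.

Set Implicit Arguments.
Unset Strict Implicit.
Unset Printing Implicit Defensive.

Import Order.TTheory GRing.Theory Num.Theory.
Import numFieldNormedType.Exports.

Local Open Scope classical_set_scope.
Local Open Scope complex_scope.
Local Open Scope ring_scope.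

(** Put N = 2^n, h = 2 pi / N and M = sqrt (2 N).  The parallelogram law gives
    |P_n|^2 + |Q_n|^2 = 2 N on the unit circle ([rudin_shapiro_energy]), so for
    G = P_n or Q_n the function log (M / |G|), called [log_deficit] below, is
    nonnegative there.  Its integral over every arc of length h turns out to be
    at most K h with an absolute constant K.  Covering [alpha, beta] by such
    arcs bounds the integral of log (M / |G|) over it by 2 K (beta - alpha) as
    soon as beta - alpha >= h, which is the theorem with c2 = exp (- 2 K).

    The bound on one arc has two ingredients.

    1. Large values at scale 1 / N ([rudin_shapiro_large]).  Write p, q for the
    two polynomials of index n - 2 and k = n - 2.  At the N-th roots of unity
    the recursion gives |G|^2 = 4 |p|^2 and 4 |q|^2 alternately, while
    |p|^2 + |q|^2 = 2^(k+1).  Multiply by a Dirichlet kernel D with 2^k terms.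
    The products D p and D q have degree less than N / 2, so by Parseval their
    square sums over the two cosets of the (N/2)-th roots of unity do not
    depend on the coset; hence the average of |G|^2 with weights |D|^2 over the
    N-th roots of unity is exactly N.  Five consecutive roots of unity around
    the centre of D carry at least 5/8 of the weight, and |G|^2 <= 2 N
    everywhere, so |G|^2 cannot be below N / 4 at all five.

    2. A Jensen-Poisson inequality ([integral_poisson_deficit_le]).  On the
    circle |G| = C prod |1 - b_j e^{it}| with all |b_j| <= 1 (reflect the zeros
    that lie inside the disc).  The function F(z) = C prod (1 - b_j z) has no
    zero in the open disc, so log |F(r e^{i tau})| is the Poisson average of
    log |F| around tau.  For r = 1 - 1/N each factor satisfies
    |1 - r b| >= (1 - 1/(2N)) |1 - b|, so |F(r e^{i tau})| >= |G(e^{i tau})| / 2.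
    Hence, if |G(e^{i tau})| is at least M / 3, the Poisson average of
    log (M / |G|) around tau is at most log 6.  The integrand is nonnegative and
    the Poisson kernel is of size N within 3 h of tau, so the integral over that
    arc is O(1 / N) ([integral_log_deficit_near]).

    The Poisson formula for one factor comes from the mean value
    int log |1 - b e^{is}| ds = 0 for |b| < 1, by the Moebius change of variable
    e^{it} = (e^{is} + r) / (1 + r e^{is}); for |b| = 1, where the logarithm is
    unbounded, Fatou's lemma gives the inequality that is needed. *)

Local Notation normc := ComplexField.Normc.normc.

(** * The modulus and the factors |1 - b e^{it}| *)

Section UnitCircle.
Variable R : realType.
Implicit Types (x y : R[i]) (r s t : R).

Lemma normcE2 x : normc x ^+ 2 = complex.Re x ^+ 2 + complex.Im x ^+ 2.
Proof. by case: x => a b /=; rewrite sqr_sqrtr// addr_ge0 ?sqr_ge0. Qed.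

Lemma normc_ge0 x : 0 <= normc x.
Proof. by case: x => a b; exact: sqrtr_ge0. Qed.

Lemma normcr r : normc r%:C = `|r|.
Proof. by rewrite /= expr0n addr0 sqrtr_sqr. Qed.

Lemma normc_conj x : normc (conjc x) = normc x.
Proof. by case: x => a b /=; rewrite sqrrN. Qed.

Lemma normcX x n : normc (x ^+ n) = normc x ^+ n.
Proof.
elim: n => [|n IH]; first by rewrite !expr0 ComplexField.Normc.normc1.
by rewrite !exprS ComplexField.Normc.normcM IH.
Qed.

Lemma normcB_ge x y : normc x - normc y <= normc (x - y).
Proof. by rewrite lerBlDr -{1}(subrK y x) le_normcD. Qed.

Lemma normc_gt0 x : (0 < normc x) = (x != 0).
Proof.
rewrite lt_neqAle normc_ge0 andbT eq_sym; congr (~~ _).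
apply/eqP/eqP => [/ComplexField.Normc.eq0_normc//|->].
exact: ComplexField.Normc.normc0.
Qed.

Lemma cis0 : cis (0 : R) = 1.
Proof. by rewrite /cis cos0 sin0. Qed.

Lemma cisD s t : cis (s + t) = cis s * cis t.
Proof. by rewrite /cis cosD sinD; simpc; congr (_ +i* _); ring. Qed.

Lemma cisM t n : cis (t *+ n) = cis t ^+ n.
Proof. by elim: n => [|n IH]; rewrite ?mulr0n ?cis0// mulrS cisD IH exprS. Qed.

Lemma normc_cis t : normc (cis t) = 1.
Proof. by rewrite /= cos2Dsin2 sqrtr1. Qed.

Lemma cis_pi : cis (pi : R) = -1.
Proof. by rewrite /cis cospi sinpi; simpc. Qed.

Lemma cis2pi t : cis (t + pi *+ 2) = cis t.
Proof. by rewrite cisD cisM cis_pi sqrrN expr1n mulr1. Qed.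

(** On the unit circle every polynomial is a constant times a product of such
    factors with |b| <= 1. *)
Definition dist1 (b : R[i]) (t : R) : R := normc (1 - b * cis t).

Lemma dist1_ge0 b t : 0 <= dist1 b t.
Proof. exact: normc_ge0. Qed.

Lemma dist1_le2 b t : normc b <= 1 -> dist1 b t <= 2.
Proof.
move=> b1; apply: le_trans (le_normcD _ _) _.
rewrite normcN ComplexField.Normc.normcM normc_cis ComplexField.Normc.normc1.
by rewrite mulr1 -[2]/(1 + 1) lerD2l.
Qed.

Lemma dist1_ge b t : 1 - normc b <= dist1 b t.
Proof.
apply: le_trans (normcB_ge _ _).
by rewrite ComplexField.Normc.normcM normc_cis ComplexField.Normc.normc1 mulr1.
Qed.

Lemma dist1_gt0 b t : normc b < 1 -> 0 < dist1 b t.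
Proof. by move=> b1; apply: lt_le_trans (dist1_ge _ _); rewrite subr_gt0. Qed.

Lemma dist1_shift b s t : dist1 b (s + t) = dist1 (b * cis s) t.
Proof. by rewrite /dist1 cisD mulrA. Qed.

Lemma dist1_periodic b t : dist1 b (t + pi *+ 2) = dist1 b t.
Proof. by rewrite /dist1 cis2pi. Qed.

Lemma dist1_double b t : dist1 (b ^+ 2) (t *+ 2) = dist1 b t * dist1 b (t + pi).
Proof.
rewrite /dist1 -ComplexField.Normc.normcM cisM cisD cis_pi; congr normc; ring.
Qed.

Lemma dist1_sqr b t : dist1 b t ^+ 2 =
  1 + normc b ^+ 2 - (complex.Re b * cos t - complex.Im b * sin t) *+ 2.
Proof.
rewrite /dist1 !normcE2; case: b => b c /=; simpc => /=.
by have := cos2Dsin2 t; nra.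
Qed.

(** 1 - r w is the combination (1 + r) / 2 (1 - w) + (1 - r) / 2 (1 + w), and the
    two summands make an acute angle because Re ((1 - w)^* (1 + w)) = 1 - |w|^2.
    Moving radially into the disc thus divides a factor by at most 2 / (1 + r),
    even when b is a zero on the circle. *)
Lemma dist1_scale_ge b r t : normc b <= 1 -> 0 <= r <= 1 ->
  (1 + r) / 2 * dist1 b t <= dist1 (r%:C * b) t.
Proof.
move=> b1 /andP[r0 r1].
rewrite -(@ler_pXn2r _ 2)// ?nnegrE ?mulr_ge0 ?divr_ge0 ?addr_ge0 ?dist1_ge0//.
rewrite [X in X <= _]exprMn !dist1_sqr ComplexField.Normc.normcM normcr.
rewrite ger0_norm// (exprMn 2 r).
have b2 : normc b ^+ 2 <= 1 by rewrite exprn_ile1 ?normc_ge0.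
have {b1} mE := normcE2 b; set m := normc b ^+ 2 in b2 mE *.
case: b @m b2 mE => b c m b2 mE; rewrite /= in mE; rewrite /= !mul0r subr0 addr0.
set u := b * cos t - c * sin t.
have -> : r * b * cos t - r * c * sin t = r * u by rewrite /u; ring.
have hu : u ^+ 2 <= m.
  rewrite mE -subr_ge0 (_ : _ - _ = (b * sin t + c * cos t) ^+ 2) ?sqr_ge0//.
  rewrite /u; have := cos2Dsin2 t; move: (cos t) (sin t) => x y xy.
  have -> : b ^+ 2 + c ^+ 2 = (b ^+ 2 + c ^+ 2) * (x ^+ 2 + y ^+ 2).
    by rewrite xy mulr1.
  ring.
have hu1 : u ^+ 2 <= 1 by apply: le_trans b2.
have u1 : -1 <= u by nra.
rewrite -subr_ge0.
have -> : 1 + r ^+ 2 * m - r * u *+ 2 - ((1 + r) / 2) ^+ 2 * (1 + m - u *+ 2) =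
  (1 - r) / 4 * ((1 - r) * (1 + m + u *+ 2) + 2 * (1 + r) * (1 - m)) by field.
have hm : 0 <= 1 + m + u *+ 2 by nra.
apply: mulr_ge0; first lra.
by apply: addr_ge0; apply: mulr_ge0; lra.
Qed.

Lemma sin_sqr_le t : sin t ^+ 2 <= t ^+ 2.
Proof.
wlog t0 : t / 0 <= t => [H|].
  have [/H//|t0] := leP 0 t.
  by have := H (- t); rewrite sinN !sqrrN; apply; rewrite oppr_ge0 ltW.
have [|c _] := @MVT_segment R sin cos 0 t t0 (fun z _ => is_derive_sin z).
  exact: continuous_subspaceT (@continuous_sin R).
rewrite sin0 !subr0 => ->; rewrite exprMn -[leRHS]mul1r ler_wpM2r ?sqr_ge0//.
Qed.

Lemma dist1_1_le t : dist1 1 t ^+ 2 <= t ^+ 2.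
Proof.
rewrite dist1_sqr ComplexField.Normc.normc1 expr1n /= mul0r mul1r subr0.
have -> : cos t = 1 - (sin (t / 2)) ^+ 2 *+ 2.
  have {1}-> : t = (t / 2) *+ 2 by rewrite -mulr_natr divfK.
  by rewrite cos_mulr2n cos2sin2; move: (sin _) => x; ring.
by have := sin_sqr_le (t / 2); lra.
Qed.

End UnitCircle.

(** * Mean value of log |1 - b e^{is}| *)

Section Calculus.
Variable R : realType.
Local Notation mu := (@lebesgue_measure R).
Implicit Types (f g F : R -> R) (a b c : R).

Lemma continuous_integrable_itv f a b : continuous f ->
  mu.-integrable `[a, b] (EFin \o f).
Proof.
move=> cf; apply: continuous_compact_integrable; first exact: segment_compact.
exact: continuous_subspaceT.
Qed.

Lemma Rintegral_substitution F f g a b : a <= b ->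
  (forall x : R, is_derive x 1 F (f x)) -> (forall x : R, 0 < f x) ->
  continuous f -> continuous g ->
  \int[mu]_(x in `[F a, F b]) g x = \int[mu]_(x in `[a, b]) (g (F x) * f x).
Proof.
move=> ab dF f0 cf cg.
have F'E : derive1 F = f by apply/funext => x; rewrite derive1E derive_val.
have cF : continuous F.
  move=> x; apply/differentiable_continuous/derivable1_diffP.
  by have [] := dF x.
rewrite /Rintegral integration_by_substitution_increasing //.
- by congr fine; apply: eq_integral => x _; rewrite F'E.
- move=> x y xab yab xy; apply: (@gtr0_derive1_lt_cc _ F a b) => //.
  + by move=> z _; rewrite F'E.
  + exact: continuous_subspaceT.
- by move=> x _; rewrite F'E; exact: cf.
- by rewrite F'E; apply/cvg_ex; exists (f a); apply: cvg_at_right_filter; exact: cf.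
- by rewrite F'E; apply/cvg_ex; exists (f b); apply: cvg_at_left_filter; exact: cf.
- split.
  + by move=> x _; have [] := dF x.
  + by apply: cvg_at_right_filter; exact: cF.
  + by apply: cvg_at_left_filter; exact: cF.
- exact: continuous_subspaceT.
Qed.

Lemma Rintegral_cat f a b c : continuous f -> a <= b -> b <= c ->
  \int[mu]_(x in `[a, c]) f x =
  \int[mu]_(x in `[a, b]) f x + \int[mu]_(x in `[b, c]) f x.
Proof.
move=> cf ab bc; apply/eqP; rewrite addrC -subr_eq; apply/eqP.
rewrite Rintegral_itvB//.
- rewrite Rintegral_itv_obnd_cbnd//; apply: integrableS (continuous_integrable_itv b c cf) => //.
  by apply: subset_itvr; rewrite bnd_simp.
- exact: continuous_integrable_itv.
Qed.

Lemma Rintegral_shift f a b c : continuous f -> a <= b ->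
  \int[mu]_(x in `[a, b]) f (x + c) = \int[mu]_(x in `[a + c, b + c]) f x.
Proof.
move=> cf ab.
have dF (x : R) : is_derive x 1 (fun y : R => y + c) 1.
  by have := is_deriveD (is_derive_id x 1) (is_derive_cst c x 1); rewrite addr0.
have c1 : continuous (fun _ : R => 1 : R) by move=> x; exact: cvg_cst.
rewrite (@Rintegral_substitution (fun x => x + c) (fun=> 1) f)//.
by apply: eq_Rintegral => x _; rewrite mulr1.
Qed.

(** Cut both intervals at [a + c] and [a + p]: they share the middle piece and the
    outer pieces differ by the period. *)
Lemma Rintegral_periodic f a c p : continuous f -> (forall x, f (x + p) = f x) ->
  0 <= c <= p ->
  \int[mu]_(x in `[a + c, a + c + p]) f x = \int[mu]_(x in `[a, a + p]) f x.
Proof.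
move=> cf fp /andP[c0 cp].
rewrite [RHS](@Rintegral_cat _ _ (a + c))//; try lra.
rewrite [LHS](@Rintegral_cat _ _ (a + p))//; try lra.
rewrite addrC (_ : a + c + p = a + p + c); last ring.
rewrite addrAC -Rintegral_shift //; last lra.
by congr (_ + _); apply: eq_Rintegral => x _; rewrite fp.
Qed.

Lemma Rintegral_itv_cst a b c : a <= b -> \int[mu]_(x in `[a, b]) c = c * (b - a).
Proof.
move=> ab; rewrite Rintegral_cst//; congr (_ * _).
rewrite [X in fine X](lebesgue_measure_itv `[a, b]%R)/= lte_fin; case: ltP => //= ba.
by apply/esym/eqP; rewrite subr_eq0 eq_le ba ab.
Qed.

Lemma le_normr_Rintegral_itv f a b c : continuous f -> a <= b ->
  (forall x, `|f x| <= c) -> `|\int[mu]_(x in `[a, b]) f x| <= c * (b - a).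
Proof.
move=> cf ab fc.
have inf := continuous_integrable_itv a b cf.
apply: le_trans (le_normr_Rintegral _ inf) _ => //.
rewrite -Rintegral_itv_cst//; apply: le_Rintegral => //.
- by apply: continuous_integrable_itv => x; apply: continuous_comp;
    [exact: cf|exact: norm_continuous].
- by apply: continuous_integrable_itv => x; exact: cvg_cst.
Qed.

Lemma continuous_dist1 (b : R[i]) : continuous (dist1 b).
Proof.
move=> t.
have -> : dist1 b = fun t => Num.sqrt
    (1 + normc b ^+ 2 - (complex.Re b * cos t - complex.Im b * sin t) *+ 2).
  by apply/funext => s; rewrite -dist1_sqr sqrtr_sqr ger0_norm ?dist1_ge0.
apply: continuous_comp; last exact: sqrt_continuous.
apply: cvgB; first exact: cvg_cst.
by apply: cvgMn; apply: cvgB; apply: cvgM; try exact: cvg_cst;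
  [exact: continuous_cos|exact: continuous_sin].
Qed.

Lemma continuous_ln_dist1 (b : R[i]) : normc b < 1 ->
  continuous (fun t => ln (dist1 b t)).
Proof.
move=> b1 t; apply: continuous_comp; first exact: continuous_dist1.
by apply: continuous_ln; exact: dist1_gt0.
Qed.

Lemma eq0_scaled_bounded c d : (forall k, 2 ^+ k * `|c| <= d) -> c = 0.
Proof.
move=> H; apply/eqP; rewrite -normr_le0 leNgt; apply/negP => c0.
have := H (Num.bound (d / `|c|)).
have d0 : 0 <= d by apply: le_trans (H 0%N); rewrite mulr_ge0// exprn_ge0.
rewrite -ler_pdivlMr// leNgt => /negP; apply.
apply: lt_le_trans (archi_boundP _) _; first by rewrite divr_ge0.
by rewrite -natrX ler_nat; apply: ltnW; exact: ltn_expl.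
Qed.

(** Take the mean of the logarithm in 1 - b^2 z^2 = (1 - b z)(1 + b z): the map
    z -> z^2 preserves means over the circle, and 1 + b z is 1 - b z turned by pi. *)
Lemma mean_ln_dist1_double (b : R[i]) : normc b < 1 ->
  \int[mu]_(s in `[- pi, pi]) ln (dist1 (b ^+ 2) s) =
  2 * \int[mu]_(s in `[- pi, pi]) ln (dist1 b s).
Proof.
move=> b1; have pi0 := pi_ge0 R.
have b21 : normc (b ^+ 2) < 1 by rewrite normcX exprn_ilt1 ?normc_ge0.
have cb := continuous_ln_dist1 b1; have cb2 := continuous_ln_dist1 b21.
have per (c : R[i]) x : ln (dist1 c (x + pi *+ 2)) = ln (dist1 c x).
  by rewrite dist1_periodic.
have Eper (c : R[i]) : normc c < 1 ->
    \int[mu]_(s in `[0, pi *+ 2]) ln (dist1 c s) =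
    \int[mu]_(s in `[- pi, pi]) ln (dist1 c s).
  move=> c1; have := @Rintegral_periodic _ (- pi) pi _
    (continuous_ln_dist1 c1) (per c).
  rewrite addNr add0r (_ : - pi + pi *+ 2 = pi) => [->//|]; last ring.
  by lra.
have Eper' : \int[mu]_(s in `[- (pi *+ 2), 0]) ln (dist1 (b ^+ 2) s) =
    \int[mu]_(s in `[- pi, pi]) ln (dist1 (b ^+ 2) s).
  have := @Rintegral_periodic _ (- (pi *+ 2)) pi _ cb2 (per (b ^+ 2)).
  rewrite addNr (_ : - (pi *+ 2) + pi = - pi); last ring.
  rewrite (_ : - pi + pi *+ 2 = pi) => [->//|]; last ring.
  by lra.
have dF (x : R) : is_derive x 1 (fun y : R => 2 * y) 2.
  by have := is_deriveZ 2 (is_derive_id x 1); rewrite /GRing.scale /= mulr1.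
have E2 : 2 * \int[mu]_(s in `[- pi, pi]) ln (dist1 (b ^+ 2) s) =
    2 * \int[mu]_(s in `[- pi, pi]) ln (dist1 (b ^+ 2) (2 * s)).
  rewrite mulr2n mulrDl mul1r -{1}Eper' -Eper// -Rintegral_cat//; try lra.
  have -> : `[- (pi *+ 2), pi *+ 2]%classic = `[2 * - pi, 2 * pi]%classic :> set R.
    by rewrite mulrN mulr_natl.
  rewrite (@Rintegral_substitution (fun x => 2 * x) (fun=> 2))//.
  - rewrite RintegralZr//; first by rewrite mulrC -mulr2n.
    apply: continuous_integrable_itv => x.
    apply: (@continuous_comp _ _ _ (fun s : R => 2 * s)
      (fun t => ln (dist1 (b ^+ 2) t))); last exact: cb2.
    exact: mulrl_continuous.
  - lra.
  - by move=> x; exact: cvg_cst.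
have {E2} -> : \int[mu]_(s in `[- pi, pi]) ln (dist1 (b ^+ 2) s) =
    \int[mu]_(s in `[- pi, pi]) ln (dist1 (b ^+ 2) (2 * s)) by lra.
have -> : 2 * \int[mu]_(s in `[- pi, pi]) ln (dist1 b s) =
    \int[mu]_(s in `[- pi, pi]) ln (dist1 b s) +
    \int[mu]_(s in `[- pi + pi, pi + pi]) ln (dist1 b s).
  by rewrite addNr -mulr2n Eper// mulr_natl mulr2n.
rewrite -Rintegral_shift//; last lra.
rewrite -RintegralD//.
- apply: eq_Rintegral => s _.
  by rewrite mulr_natl dist1_double lnM// posrE dist1_gt0.
- exact: continuous_integrable_itv.
- apply: continuous_integrable_itv => x.
  apply: (@continuous_comp _ _ _ (fun s : R => s + pi)
    (fun t => ln (dist1 b t))); last exact: cb.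
  by apply: cvgD; [exact: cvg_id|exact: cvg_cst].
Qed.

(** The mean value property of the harmonic function log |1 - b z|, obtained by
    iterating the doubling identity: 2^k times the mean for b is the mean for
    b^(2^k), and the latter stays bounded since |b^(2^k)| <= |b| < 1. *)
Lemma mean_ln_dist1 (b : R[i]) : normc b < 1 ->
  \int[mu]_(s in `[- pi, pi]) ln (dist1 b s) = 0.
Proof.
move=> b1; have pi0 := pi_ge0 R.
apply: (@eq0_scaled_bounded _ ((ln 2 - ln (1 - normc b)) * (pi - - pi))) => k.
have bk1 k' : normc (b ^+ (2 ^ k')) <= normc b.
  by rewrite normcX ler_iXnr ?expn_gt0// ?normc_ge0// ltW.
have -> : 2 ^+ k * `|\int[mu]_(s in `[- pi, pi]) ln (dist1 b s)| =
    `|\int[mu]_(s in `[- pi, pi]) ln (dist1 (b ^+ (2 ^ k)) s)|.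
  elim: k => [|k IH]; first by rewrite expn0 !expr1 mul1r.
  rewrite expnSr exprM mean_ln_dist1_double ?(le_lt_trans (bk1 _))//.
  by rewrite normrM (ger0_norm (ler0n _ 2)) exprS -mulrA IH.
apply: le_normr_Rintegral_itv => [||x].
- by apply: continuous_ln_dist1; exact: le_lt_trans (bk1 _) _.
- lra.
have q0 : 0 < 1 - normc b by rewrite subr_gt0.
have hle : 1 - normc b <= dist1 (b ^+ (2 ^ k)) x.
  by apply: le_trans (dist1_ge _ _); rewrite lerD2l lerN2.
have hge : dist1 (b ^+ (2 ^ k)) x <= 2.
  by apply: dist1_le2; apply: le_trans (bk1 k) (ltW b1).
have d0 := lt_le_trans q0 hle.
have l1 : ln (1 - normc b) <= ln (dist1 (b ^+ (2 ^ k)) x) by rewrite ler_ln ?posrE.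
have l2 : ln (dist1 (b ^+ (2 ^ k)) x) <= ln 2 by rewrite ler_ln ?posrE.
have l3 : ln (1 - normc b) <= 0.
  by rewrite -ln1 ler_ln// ?posrE// gerBl normc_ge0.
have l4 : 0 <= ln (2 : R) by rewrite ln_ge0// ler1n.
by rewrite ler_norml; apply/andP; split; lra.
Qed.

End Calculus.

(** * Poisson formula for one factor *)

Section Poisson.
Variable R : realType.
Local Notation mu := (@lebesgue_measure R).
Implicit Types (r s t : R) (b : R[i]).

(** The gap is positive when |b| < 1 and |r| < 1, so (b - r) / (1 - r b) stays in the disc. *)
Lemma normc_mobius_gap b r : normc (1 - r%:C * b) ^+ 2 - normc (b - r%:C) ^+ 2 =
  (1 - r ^+ 2) * (1 - normc b ^+ 2).
Proof. by rewrite !normcE2; case: b => b c; simpc => /=; ring. Qed.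

(** The angle t with e^{it} = (e^{is} + r) / (1 + r e^{is}), see [cis_mobius_angle]:
    the quotient is e^{is} w^* / w with w = 1 + r e^{is}, and w has positive real
    part, so its argument is an arctangent and the angle is smooth in s. *)
Definition mobius_angle r s : R := s - 2 * atan (r * sin s / (1 + r * cos s)).

Definition poisson r t : R := (1 - r ^+ 2) / dist1 r%:C t ^+ 2.

Lemma dist1N_sqr r s : dist1 (- r)%:C s ^+ 2 = (1 + r * cos s) ^+ 2 + (r * sin s) ^+ 2.
Proof.
rewrite dist1_sqr normcr real_normK ?num_real//= sqrrN.
transitivity (1 + r ^+ 2 * (cos s ^+ 2 + sin s ^+ 2) + 2 * r * cos s).
  by rewrite cos2Dsin2; ring.
by ring.
Qed.

Lemma oneDcos_gt0 r s : 0 <= r < 1 -> 0 < 1 + r * cos s.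
Proof. by have := cos_geN1 s; nra. Qed.

Lemma is_derive_mobius_angle r s : 0 <= r < 1 ->
  is_derive s 1 (mobius_angle r) ((1 - r ^+ 2) / dist1 (- r)%:C s ^+ 2).
Proof.
move=> r01; have w0 := oneDcos_gt0 s r01.
pose w s := 1 + r * cos s.
have w1 : w s != 0 by exact: lt0r_neq0.
have dw : is_derive s 1 w (- r * sin s).
  have := is_deriveD (is_derive_cst (1 : R) s 1) (is_deriveZ r (is_derive_cos s)).
  by move=> h; apply: is_derive_eq; rewrite /GRing.scale/= add0r mulrN mulNr.
have dv : is_derive s 1 (fun s => (w s)^-1) (r * sin s / w s ^+ 2).
  apply: (is_derive_eq (is_deriveV w1 dw)).
  by rewrite /GRing.scale/= -/(w s); field.
have du : is_derive s 1 (fun s => r * sin s / w s)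
    ((r * cos s * w s + (r * sin s) ^+ 2) / w s ^+ 2).
  apply: (is_derive_eq (is_deriveM (is_deriveZ r (is_derive_sin s)) dv)).
  by rewrite /GRing.scale/= /GRing.scale/= -/(w s); field.
have da := @is_derive1_comp _ atan _ s _ _ (is_derive1_atan _) du.
apply: (is_derive_eq (is_deriveB (is_derive_id s 1) (is_deriveZ 2 da))).
rewrite /GRing.scale/= dist1N_sqr -/(w s).
have e : (w s) ^+ 2 + (r * sin s) ^+ 2 != 0.
  by rewrite lt0r_neq0// ltr_wpDr ?sqr_ge0// exprn_gt0.
have -> : (1 + (r * sin s / w s) ^+ 2)^-1 = w s ^+ 2 / (w s ^+ 2 + (r * sin s) ^+ 2).
  rewrite expr_div_n -[X in (X + _)^-1](@divff _ (w s ^+ 2)) ?expf_neq0//.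
  by rewrite -mulrDl invf_div.
have -> : 1 - r ^+ 2 = w s ^+ 2 + (r * sin s) ^+ 2 -
    2 * (r * cos s * w s + (r * sin s) ^+ 2).
  transitivity (1 - r ^+ 2 * (cos s ^+ 2 + sin s ^+ 2)); last by rewrite /w; ring.
  by rewrite cos2Dsin2 mulr1.
by field; rewrite w1 e.
Qed.

Lemma cis_mobius_angle r s : 0 <= r < 1 ->
  cis (mobius_angle r s) * (1 + r%:C * cis s) = cis s + r%:C.
Proof.
move=> r01; have w0 := oneDcos_gt0 s r01.
rewrite /mobius_angle; set w := 1 + r * cos s in w0 *; set a := atan _.
have x0 : 0 < cos a by rewrite cos_gt0_pihalf// atan_gtNpi2 atan_ltpi2.
have ya : sin a = (r * sin s / w) * cos a.
  by rewrite -[_ / w]atanK -/a /tan divfK// gt_eqF.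
have h1 : 1 + r%:C * cis s = (w / cos a)%:C * cis a.
  rewrite /cis ya; simpc; congr (_ +i* _); first by rewrite divfK// gt_eqF.
  by field; rewrite !gt_eqF.
have h2 : 1 + r%:C * cis (- s) = (w / cos a)%:C * cis (- a).
  rewrite /cis !cosN !sinN ya; simpc; congr (_ +i* _); first by rewrite divfK// gt_eqF.
  by field; rewrite !gt_eqF.
have aa : cis (- a) * cis a = 1 by rewrite -cisD addNr cis0.
have ss : cis s * cis (- s) = 1 by rewrite -cisD subrr cis0.
have -> : s - 2 * a = s + (- a) + (- a) by ring.
rewrite !cisD h1.
transitivity (cis s * ((w / cos a)%:C * cis (- a)) * (cis (- a) * cis a)); first by ring.
rewrite aa mulr1 -h2 mulrDr mulr1 mulrCA ss mulr1; ring.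
Qed.

(** Substituting the Moebius map in 1 - b z gives
    ((1 - r b) - (b - r) e^{is}) / (1 + r e^{is}), whose numerator and denominator
    are again of the form constant times 1 - c e^{is}. *)
Lemma dist1_mobius_angle b r s : 0 <= r < 1 -> normc b <= 1 ->
  dist1 b (mobius_angle r s) * dist1 (- r)%:C s =
  normc (1 - r%:C * b) * dist1 ((b - r%:C) / (1 - r%:C * b)) s.
Proof.
move=> r01 b1.
have nz : 1 - r%:C * b != 0.
  rewrite -normc_gt0; apply: lt_le_trans (normcB_ge _ _).
  rewrite ComplexField.Normc.normc1 ComplexField.Normc.normcM normcr.
  by rewrite ger0_norm; [nra|lra].
rewrite /dist1 -!ComplexField.Normc.normcM; congr normc.
rewrite [RHS]mulrBr mulr1 mulrA mulrCA divff// mulr1.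
rewrite rmorphN mulNr opprK mulrBl mul1r -mulrA cis_mobius_angle//; ring.
Qed.

Lemma normc_lt1_1B b r : 0 <= r < 1 -> normc b <= 1 -> 0 < normc (1 - r%:C * b).
Proof.
move=> r01 b1; apply: lt_le_trans (normcB_ge _ _).
rewrite ComplexField.Normc.normc1 ComplexField.Normc.normcM normcr.
by rewrite ger0_norm; [nra|lra].
Qed.

Lemma mobius_disc b r : 0 <= r < 1 -> normc b < 1 ->
  normc ((b - r%:C) / (1 - r%:C * b)) < 1.
Proof.
move=> r01 b1; have h := normc_lt1_1B r01 (ltW b1).
rewrite ComplexField.Normc.normcM ComplexField.Normc.normcV.
rewrite ltr_pdivrMr// mul1r -(@ltr_pXn2r _ 2)// ?nnegrE ?normc_ge0//.
rewrite -subr_gt0 normc_mobius_gap mulr_gt0// subr_gt0 exprn_ilt1 ?normc_ge0//; lra.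
Qed.

(** The Poisson kernel is the Jacobian of the Moebius change of variable. *)
Lemma poisson_mobius_angle r s : 0 <= r < 1 ->
  poisson r (mobius_angle r s) * ((1 - r ^+ 2) / dist1 (- r)%:C s ^+ 2) = 1.
Proof.
move=> r01; have rc : normc r%:C <= 1 by rewrite normcr ger0_norm; lra.
have nrc : normc (- r)%:C < 1 by rewrite normcr normrN ger0_norm; lra.
have rc1 : normc r%:C < 1 by rewrite normcr ger0_norm; lra.
have := dist1_mobius_angle s r01 rc.
have -> : dist1 ((r%:C - r%:C) / (1 - r%:C * r%:C)) s = 1.
  by rewrite subrr mul0r /dist1 mul0r subr0 ComplexField.Normc.normc1.
rewrite (_ : 1 - r%:C * r%:C = (1 - r ^+ 2)%:C); last first.
  by rewrite rmorphB rmorph1 rmorphXn expr2.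
rewrite mulr1 normcr ger0_norm; last nra.
rewrite /poisson => <-.
have d1 := dist1_gt0 (mobius_angle r s) rc1; have d2 := dist1_gt0 s nrc.
by field; rewrite !gt_eqF.
Qed.

Lemma continuous_poisson r : 0 <= r < 1 -> continuous (poisson r).
Proof.
move=> r01 t; apply: cvgM; first exact: cvg_cst.
have rc1 : normc r%:C < 1 by rewrite normcr ger0_norm; lra.
apply: cvgV; first by rewrite lt0r_neq0// exprn_gt0// dist1_gt0.
apply: (@continuous_comp _ _ _ (dist1 r%:C) (fun x => x ^+ 2)).
  exact: continuous_dist1.
exact: exprn_continuous.
Qed.

Lemma mobius_angle_pi r : mobius_angle r pi = pi.
Proof. by rewrite /mobius_angle sinpi mulr0 mul0r atan0 mulr0 subr0. Qed.

Lemma mobius_angleNpi r : mobius_angle r (- pi) = - pi.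
Proof. by rewrite /mobius_angle sinN sinpi oppr0 mulr0 mul0r atan0 mulr0 subr0. Qed.

Lemma Rintegral_poisson r (f : R -> R) : 0 <= r < 1 -> continuous f ->
  \int[mu]_(t in `[- pi, pi]) (poisson r t * f t) =
  \int[mu]_(s in `[- pi, pi]) f (mobius_angle r s).
Proof.
move=> r01 cf; have pi0 := pi_ge0 R.
have nrc : normc (- r)%:C < 1 by rewrite normcr normrN ger0_norm; lra.
have pipi : - pi <= pi :> R by lra.
have := @Rintegral_substitution R (mobius_angle r)
  (fun s => (1 - r ^+ 2) / dist1 (- r)%:C s ^+ 2)
  (fun t => poisson r t * f t) (- pi) pi pipi
  (fun s => is_derive_mobius_angle s r01).
rewrite mobius_angle_pi mobius_angleNpi => ->.
- by apply: eq_Rintegral => s _; rewrite mulrAC poisson_mobius_angle// mul1r.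
- by move=> s; rewrite divr_gt0// ?exprn_gt0 ?dist1_gt0//; nra.
- move=> t; apply: cvgM; first exact: cvg_cst.
  apply: cvgV; first by rewrite lt0r_neq0// exprn_gt0// dist1_gt0.
  apply: (@continuous_comp _ _ _ (dist1 (- r)%:C) (fun x => x ^+ 2)).
    exact: continuous_dist1.
  exact: exprn_continuous.
- by move=> t; apply: cvgM; [exact: continuous_poisson|exact: cf].
Qed.

Lemma Rintegral_poisson1 r : 0 <= r < 1 ->
  \int[mu]_(t in `[- pi, pi]) poisson r t = 2 * pi.
Proof.
move=> r01; have := @Rintegral_poisson r (fun=> 1) r01.
under eq_Rintegral do rewrite mulr1.
move=> ->; last by move=> x; exact: cvg_cst.
by rewrite Rintegral_itv_cst; have := pi_ge0 R; lra.
Qed.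

(** After the Moebius change of variable only the constant factor 1 - r b
    contributes, the two others having mean zero. *)
Lemma Rintegral_poisson_ln_dist1 b r : 0 <= r < 1 -> normc b < 1 ->
  \int[mu]_(t in `[- pi, pi]) (poisson r t * ln (dist1 b t)) =
  2 * pi * ln (normc (1 - r%:C * b)).
Proof.
move=> r01 b1; have pi0 := pi_ge0 R.
have nrc : normc (- r)%:C < 1 by rewrite normcr normrN ger0_norm; lra.
rewrite Rintegral_poisson//; last exact: continuous_ln_dist1.
set c := (b - r%:C) / (1 - r%:C * b).
have c1 : normc c < 1 by exact: mobius_disc.
have k0 := normc_lt1_1B r01 (ltW b1).
set k := normc _ in k0 *.
transitivity (\int[mu]_(s in `[- pi, pi])
   (ln k + (ln (dist1 c s) - ln (dist1 (- r)%:C s)))).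
  apply: eq_Rintegral => s _.
  apply/eqP; rewrite addrA eq_sym subr_eq; apply/eqP.
  rewrite -!lnM ?posrE ?dist1_gt0//; congr ln.
  by rewrite dist1_mobius_angle// ltW.
have cc := continuous_ln_dist1 c1; have cr := continuous_ln_dist1 nrc.
have ic := continuous_integrable_itv (- pi) pi cc.
have ir := continuous_integrable_itv (- pi) pi cr.
rewrite RintegralD//.
- rewrite RintegralB// !mean_ln_dist1// Rintegral_itv_cst; last lra.
  by rewrite subr0 addr0; ring.
- by apply: continuous_integrable_itv => x; exact: cvg_cst.
- by apply: continuous_integrable_itv => x; apply: cvgB; [exact: cc|exact: cr].
Qed.

End Poisson.

(** * Factors vanishing on the circle *)

Section JensenPoisson.
Variable R : realType.
Local Notation mu := (@lebesgue_measure R).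
Local Notation circle := (`[(- pi)%R, pi%R]%classic : set R).
Implicit Types (r s t : R) (b : R[i]).

Lemma measurable_lne_EFin (f : R -> R) : measurable_fun [set: R] f ->
  measurable_fun [set: R] (fun t => lne (f t)%:E).
Proof.
move=> mf; apply: measurable_fun_ifT => //.
  by apply: measurable_fun_ler.
by apply/measurable_EFinP; exact: measurableT_comp.
Qed.

(** The continuity of the extended logarithm on [0, +oo[, where the value at 0
    is -oo. *)
Lemma cvg_lne (u : nat -> R) (l : R) : (forall n, 0 < u n) ->
  u n @[n --> \oo] --> l -> lne (u n)%:E @[n --> \oo] --> lne l%:E.
Proof.
move=> u0 ul; under eq_fun do rewrite lne_EFin//.
have l0 : 0 <= l.
  rewrite -(cvg_lim _ ul)//; apply: limr_ge; first by apply/cvg_ex; exists l.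
  by apply: nearW => n; exact: ltW.
move: l0; rewrite le_eqVlt => /predU1P[l0|l0]; last first.
  rewrite lne_EFin//; apply: cvg_EFin; first exact: nearW.
  by apply: (@continuous_cvg _ _ _ _ _ u (@ln R) l) => //; exact: continuous_ln.
rewrite -l0 le0_lneNy//; apply/cvgeNyPle => A.
have /cvgrPdist_lt/(_ _ (expR_gt0 A)) := ul; rewrite -l0.
apply: filterS => n; rewrite sub0r normrN gtr0_norm// => h.
rewrite lee_fin -(expRK A) ler_ln ?posrE ?expR_gt0//; exact: ltW.
Qed.

Lemma cvg_dist1_scale b t (u : nat -> R) : u n @[n --> \oo] --> (1 : R) ->
  dist1 ((u n)%:C * b) t @[n --> \oo] --> dist1 b t.
Proof.
move=> u1.
pose f x := Num.sqrt (1 + x ^+ 2 * normc b ^+ 2 -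
    x * (complex.Re b * cos t - complex.Im b * sin t) *+ 2).
have fE x : dist1 (x%:C * b) t = f x.
  rewrite -[LHS]ger0_norm ?dist1_ge0// -sqrtr_sqr dist1_sqr /f.
  rewrite ComplexField.Normc.normcM normcr exprMn real_normK ?num_real//.
  congr (Num.sqrt (_ - _ *+ 2)); case: b {f} => b c; simpc => /=; ring.
under eq_fun do rewrite fE.
have -> : dist1 b t = f 1 by rewrite -fE mul1r.
apply: (@continuous_cvg _ _ _ _ _ u f 1) => //.
apply: continuous_comp; last exact: sqrt_continuous.
apply: cvgB.
  apply: cvgD; first exact: cvg_cst.
  by apply: cvgM; [exact: exprn_continuous|exact: cvg_cst].
by apply: cvgMn; apply: cvgM; [exact: cvg_id|exact: cvg_cst].
Qed.

(** The factor is at most 2, so dividing by 2 gives a nonnegative function, to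
    which the integration theory of nonnegative extended functions applies. *)
Definition nlog2 b t : \bar R := (- lne (dist1 b t / 2)%:E)%E.

Lemma nlog2_ge0 b t : normc b <= 1 -> (0 <= nlog2 b t)%E.
Proof.
move=> b1; rewrite /nlog2 oppe_ge0 lne_le0 lee_fin.
by rewrite ler_pdivrMr// mul1r dist1_le2.
Qed.

Lemma measurable_nlog2 b (D : set R) : measurable_fun D (nlog2 b).
Proof.
apply: measurable_funTS; apply: measurableT_comp => //.
apply: measurable_lne_EFin; apply: continuous_measurable_fun => t.
by apply: cvgM; [exact: continuous_dist1|exact: cvg_cst].
Qed.

Lemma poisson_gt0 r t : 0 <= r < 1 -> 0 < poisson r t.
Proof.
move=> r01; have rc1 : normc r%:C < 1 by rewrite normcr ger0_norm; lra.
by rewrite divr_gt0 ?exprn_gt0 ?dist1_gt0//; nra.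
Qed.

Lemma measurable_poisson r (D : set R) : 0 <= r < 1 ->
  measurable_fun D (fun t => (poisson r t)%:E).
Proof.
move=> r01; apply: measurable_funTS; apply/measurable_EFinP.
apply: continuous_measurable_fun; exact: continuous_poisson.
Qed.

Lemma integral_poisson_nlog2_lt1 b r : 0 <= r < 1 -> normc b < 1 ->
  (\int[mu]_(t in circle) ((poisson r t)%:E * nlog2 b t) =
   (2 * pi * - ln (normc (1 - r%:C * b) / 2))%:E)%E.
Proof.
move=> r01 b1.
have d0 t : 0 < dist1 b t / 2 by rewrite divr_gt0// dist1_gt0.
have cl := continuous_ln_dist1 b1; have cp := continuous_poisson r01.
have ci : continuous (fun t => poisson r t * ln (dist1 b t)).
  by move=> t; apply: cvgM; [exact: cp|exact: cl].
have ci2 : continuous (fun t => ln 2 * poisson r t).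
  by move=> t; apply: cvgM; [exact: cvg_cst|exact: cp].
transitivity (\int[mu]_(t in circle)
    (ln 2 * poisson r t - poisson r t * ln (dist1 b t))%:E)%E.
  apply: eq_integral => t _; rewrite /nlog2 lne_EFin// -EFinN -EFinM.
  by rewrite ln_div ?posrE ?dist1_gt0//; congr EFin; ring.
rewrite -[LHS]fineK; last first.
  apply: integrable_fin_num => //; apply: continuous_integrable_itv => t.
  by apply: cvgB; [exact: ci2|exact: ci].
congr EFin; rewrite -/(Rintegral _ _ _) RintegralB//; try exact: continuous_integrable_itv.
rewrite RintegralZl//; last exact: continuous_integrable_itv.
have k0 := normc_lt1_1B r01 (ltW b1).
rewrite Rintegral_poisson1// Rintegral_poisson_ln_dist1// ln_div ?posrE//.
ring.
Qed.

(** For |b| = 1 the integrand has a singularity; it is the limit of the integrands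
    for (1 - 1/m) b, and Fatou's lemma preserves the inequality. *)
Lemma integral_poisson_nlog2_le b r : 0 <= r < 1 -> normc b <= 1 ->
  (\int[mu]_(t in circle) ((poisson r t)%:E * nlog2 b t) <=
   (2 * pi * - ln (normc (1 - r%:C * b) / 2))%:E)%E.
Proof.
move=> r01 b1.
pose u n : R := 1 - harmonic n.
have u1 : u n @[n --> \oo] --> (1 : R).
  by rewrite -[X in _ --> X]subr0; apply: cvgB; [exact: cvg_cst|exact: cvg_harmonic].
have h01 n : 0 < (harmonic n : R) <= 1.
  by rewrite /harmonic/= invr_gt0 ltr0n/= invf_le1 ?ler1n.
have ub n : normc ((u n)%:C * b) < 1.
  rewrite ComplexField.Normc.normcM normcr.
  have b0 := normc_ge0 b; have /andP[h0 h1] := h01 n; rewrite /u.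
  move: (harmonic n) h0 h1 => h h0 h1.
  by rewrite ger0_norm; [nra|lra].
have lim2 : ((2 * pi * - ln (normc (1 - r%:C * ((u n)%:C * b)) / 2))%:E
    @[n --> \oo] --> (2 * pi * - ln (normc (1 - r%:C * b) / 2))%:E)%E.
  apply: cvg_EFin; first exact: nearW.
  apply: cvgM; first exact: cvg_cst.
  apply: cvgN.
  apply: (@continuous_cvg _ _ _ _ _
    (fun n => normc (1 - r%:C * ((u n)%:C * b)) / 2) (@ln R)
    (normc (1 - r%:C * b) / 2)).
    by apply: continuous_ln; rewrite divr_gt0// normc_lt1_1B.
  apply: cvgM; last exact: cvg_cst.
  have := @cvg_dist1_scale (r%:C * b) 0 _ u1.
  rewrite /dist1 cis0 mulr1; under eq_fun do rewrite mulr1 mulrCA.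
  exact.
rewrite -(cvg_limn_einf_sup lim2).1.
under [X in limn_einf X]eq_fun do rewrite -(integral_poisson_nlog2_lt1 r01 (ub _)).
have cv t : (((poisson r t)%:E * nlog2 ((u n)%:C * b)%R t) @[n --> \oo] -->
    (poisson r t)%:E * nlog2 b t)%E.
  apply: cvgeZl => //; apply: cvgeN; apply: cvg_lne.
    by move=> n; rewrite divr_gt0// dist1_gt0.
  by apply: cvgM; [exact: cvg_dist1_scale|exact: cvg_cst].
apply: le_trans (fatou mu _ _ _) => //.
- rewrite le_eqVlt; apply/orP; left; apply/eqP; apply: eq_integral => t _.
  by rewrite (cvg_limn_einf_sup (cv t)).1.
- by move=> n; apply: emeasurable_funM;
    [exact: measurable_poisson|exact: measurable_nlog2].
- move=> n t _; rewrite mule_ge0 ?lee_fin ?(ltW (poisson_gt0 _ _))//.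
  by apply: nlog2_ge0; exact: ltW.
Qed.

End JensenPoisson.

(** * Jensen-Poisson inequality for products *)

Section LogIntegral.
Variable R : realType.
Local Notation mu := (@lebesgue_measure R).
Local Notation circle := (`[(- pi)%R, pi%R]%classic : set R).
Implicit Types (r s t C : R) (b : R[i]) (bs : seq R[i]).

Lemma lneN_prod_dist1 C bs t : 0 < C -> {in bs, forall b, normc b <= 1} ->
  (- lne (C * \prod_(b <- bs) dist1 b t)%:E =
   (- ln (C * 2 ^+ size bs))%:E + \sum_(b <- bs) nlog2 b t)%E.
Proof.
elim: bs C => [|b bs IH] C C0 hb.
  by rewrite !big_nil adde0 [size _]/= expr0 !mulr1 lne_EFin.
have hb' : {in bs, forall b, normc b <= 1}.
  by move=> c cbs; apply: hb; rewrite inE cbs orbT.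
rewrite !big_cons; have := dist1_ge0 b t; rewrite le_eqVlt => /predU1P[d0|d0].
  rewrite -d0 mul0r mulr0 le0_lneNy//= {1}/nlog2 -d0 mul0r le0_lneNy//=.
  rewrite addye ?addey// -ltNye (@lt_le_trans _ _ 0%E) ?ltNy0//.
  by rewrite big_seq sume_ge0// => c /hb'; exact: nlog2_ge0.
rewrite mulrA IH ?mulr_gt0// /nlog2 lne_EFin ?divr_gt0//.
rewrite addeA -EFinN -EFinD; congr (_%:E + _)%E.
rewrite exprS !lnM ?posrE ?mulr_gt0 ?exprn_gt0// lnV ?posrE//.
by ring.
Qed.

Lemma sum_nlog2_ge0 bs t : {in bs, forall b, normc b <= 1} ->
  (0 <= \sum_(b <- bs) nlog2 b t)%E.
Proof. by move=> hb; rewrite big_seq sume_ge0// => c /hb; exact: nlog2_ge0. Qed.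

Lemma measurable_sum_nlog2 bs (D : set R) :
  measurable_fun D (fun t => \sum_(b <- bs) nlog2 b t)%E.
Proof. by apply: emeasurable_sum => b; exact: measurable_nlog2. Qed.

Lemma integral_poisson_sum_nlog2_le bs r : 0 <= r < 1 ->
  {in bs, forall b, normc b <= 1} ->
  (\int[mu]_(t in circle) ((poisson r t)%:E * \sum_(b <- bs) nlog2 b t) <=
   (2 * pi * \sum_(b <- bs) - ln (normc (1 - r%:C * b) / 2))%:E)%E.
Proof.
move=> r01; elim: bs => [|b bs IH] hb.
  rewrite big_nil mulr0; under eq_integral do rewrite big_nil mule0.
  by rewrite integral0.
have hb' : {in bs, forall b, normc b <= 1}.
  by move=> c cbs; apply: hb; rewrite inE cbs orbT.
have b1 : normc b <= 1 by apply: hb; rewrite inE eqxx.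
under eq_integral => t _.
  rewrite big_cons ge0_muleDr; [|exact: nlog2_ge0|exact: sum_nlog2_ge0]; over.
have p0 t : (0 <= (poisson r t)%:E)%E by rewrite lee_fin ltW// poisson_gt0.
rewrite ge0_integralD//=.
- rewrite big_cons mulrDr EFinD; apply: leeD; last exact: IH.
  exact: integral_poisson_nlog2_le.
- by move=> t _; rewrite mule_ge0// nlog2_ge0.
- by apply: emeasurable_funM; [exact: measurable_poisson|exact: measurable_nlog2].
- by move=> t _; rewrite mule_ge0// sum_nlog2_ge0.
- by apply: emeasurable_funM; [exact: measurable_poisson|exact: measurable_sum_nlog2].
Qed.

Lemma integral_poisson_cst r C : 0 <= r < 1 ->
  (\int[mu]_(t in circle) ((poisson r t)%:E * C%:E) = (2 * pi * C)%:E)%E.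
Proof.
move=> r01; have cp := continuous_poisson r01.
have ip := continuous_integrable_itv (- pi) pi cp.
have ci : continuous (fun t => poisson r t * C).
  by move=> t; apply: cvgM; [exact: cp|exact: cvg_cst].
rewrite -[LHS]fineK; last first.
  exact: (integrable_fin_num _ (continuous_integrable_itv (- pi) pi ci)).
by congr EFin; rewrite -/(Rintegral _ _ _) RintegralZr// Rintegral_poisson1.
Qed.

Definition prodlin C bs t : R := C * \prod_(b <- bs) dist1 b t.

Lemma prodlin_ge0 C bs t : 0 < C -> 0 <= prodlin C bs t.
Proof. by move=> C0; rewrite mulr_ge0 ?prodr_ge0 ?ltW// => b _; exact: dist1_ge0. Qed.

Lemma measurable_lne_prodlin C bs (D : set R) :
  measurable_fun D (fun t => lne (prodlin C bs t)%:E).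
Proof.
apply: measurable_funTS; apply: measurable_lne_EFin.
apply: measurable_funM => //; apply: measurable_prod => b _.
by apply: continuous_measurable_fun; exact: continuous_dist1.
Qed.

Lemma deficit_ge0 (M y : R) : 0 <= y <= M -> (0 <= (ln M)%:E - lne y%:E)%E.
Proof.
move=> /andP[]; rewrite le_eqVlt => /predU1P[<- _|y0 yM].
  by rewrite le0_lneNy//= leey.
rewrite lne_EFin// -EFinB lee_fin subr_ge0 ler_ln ?posrE//.
exact: lt_le_trans yM.
Qed.

(** The right-hand side is 2 pi log (M / |F(r)|) with F(z) = C prod (1 - b z).
    The kernel has total mass 2 pi, so the constants that separate log (M / |F|)
    from the sum of the nonnegative [nlog2 b] can be moved across. *)
Lemma integral_poisson_deficit_le C bs M r : 0 < C ->
  {in bs, forall b, normc b <= 1} -> (forall t, prodlin C bs t <= M) -> 0 <= r < 1 ->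
  (\int[mu]_(t in circle)
     ((poisson r t)%:E * ((ln M)%:E - lne (prodlin C bs t)%:E)) <=
   (2 * pi * (ln M - ln (C * \prod_(b <- bs) normc (1 - r%:C * b))))%:E)%E.
Proof.
move=> C0 hb FM r01.
(* k may be negative, so |k| is added to stay among nonnegative functions *)
pose c0 := ln (C * 2 ^+ size bs); pose k := ln M - c0.
have p0 t : (0 <= (poisson r t)%:E)%E by rewrite lee_fin ltW// poisson_gt0.
have S0 t := sum_nlog2_ge0 t hb.
have w0 t : (0 <= (ln M)%:E - lne (prodlin C bs t)%:E)%E.
  by rewrite deficit_ge0// prodlin_ge0/=.
have mw : measurable_fun circle (fun t => (ln M)%:E - lne (prodlin C bs t)%:E)%E.
  by apply: emeasurable_funB => //; exact: measurable_lne_prodlin.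
have kk0 : 0 <= k + `|k| by rewrite -lerBlDl sub0r -normrN ler_norm.
have wE t : ((ln M)%:E - lne (prodlin C bs t)%:E + `|k|%:E =
    \sum_(b <- bs) nlog2 b t + (k + `|k|)%:E)%E.
  rewrite /prodlin lneN_prod_dist1// addeA -EFinB [in RHS]EFinD addeA.
  by congr (_ + _)%E; rewrite addeC.
have H : (\int[mu]_(t in circle)
     ((poisson r t)%:E * ((ln M)%:E - lne (prodlin C bs t)%:E)) + (2 * pi * `|k|)%:E =
  \int[mu]_(t in circle) ((poisson r t)%:E * \sum_(b <- bs) nlog2 b t) +
    (2 * pi * (k + `|k|))%:E)%E.
  rewrite -!(@integral_poisson_cst r)// -!ge0_integralD//.
  - apply: eq_integral => t _.
    rewrite -!ge0_muleDr// ?lee_fin//.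
    by rewrite wE.
  - by move=> t _; rewrite mule_ge0.
  - by apply: emeasurable_funM; [exact: measurable_poisson|exact: measurable_sum_nlog2].
  - by move=> t _; rewrite mule_ge0.
  - by apply: emeasurable_funM => //; exact: measurable_poisson.
  - by move=> t _; rewrite mule_ge0.
  - by apply: emeasurable_funM => //; exact: measurable_poisson.
  - by move=> t _; rewrite mule_ge0.
  - by apply: emeasurable_funM => //; exact: measurable_poisson.
rewrite -(@leeD2rE _ (2 * pi * `|k|)%:E)// H.
apply: le_trans (leeD2r _ (integral_poisson_sum_nlog2_le r01 hb)) _.
rewrite -!EFinD lee_fin -!mulrDr.
rewrite le_eqVlt; apply/orP; left; apply/eqP; congr (_ * _).
suff -> : \sum_(b <- bs) - ln (normc (1 - r%:C * b) / 2) =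
    c0 - ln (C * \prod_(b <- bs) normc (1 - r%:C * b)) by rewrite /k; ring.
rewrite /c0.
elim: bs {FM k c0 S0 w0 mw kk0 wE H} C hb C0 => [|b bs IH] C hb C0.
  by rewrite !big_nil expr0 subrr.
have hb' : {in bs, forall b, normc b <= 1}.
  by move=> c cbs; apply: hb; rewrite inE cbs orbT.
have b1 : normc b <= 1 by apply: hb; rewrite inE eqxx.
have k0 := normc_lt1_1B r01 b1.
rewrite !big_cons (IH C)// exprS.
have P0 : 0 < \prod_(j <- bs) normc (1 - r%:C * j).
  rewrite big_seq; apply: prodr_gt0 => c /hb'; exact: normc_lt1_1B.
rewrite !lnM ?posrE ?mulr_gt0 ?exprn_gt0 ?invr_gt0// lnV ?posrE//.
by ring.
Qed.

(** The integrand is nonnegative, so the arc where the kernel is at least k can be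
    isolated without loss. *)
Lemma integral_deficit_local C bs M r d k : 0 < C ->
  {in bs, forall b, normc b <= 1} -> (forall t, prodlin C bs t <= M) -> 0 <= r < 1 ->
  0 <= k -> d <= pi -> (forall t, `|t| <= d -> k <= poisson r t) ->
  (k%:E * \int[mu]_(t in `[(- d)%R, d]) ((ln M)%:E - lne (prodlin C bs t)%:E) <=
   (2 * pi * (ln M - ln (C * \prod_(b <- bs) normc (1 - r%:C * b))))%:E)%E.
Proof.
move=> C0 hb FM r01 k0 dpi kd.
apply: le_trans (integral_poisson_deficit_le C0 hb FM r01).
have w0 t : (0 <= (ln M)%:E - lne (prodlin C bs t)%:E)%E.
  by rewrite deficit_ge0// prodlin_ge0/=.
have p0 t : (0 <= (poisson r t)%:E)%E by rewrite lee_fin ltW// poisson_gt0.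
have mw (D : set R) : measurable_fun D (fun t => (ln M)%:E - lne (prodlin C bs t)%:E)%E.
  by apply: emeasurable_funB => //; exact: measurable_lne_prodlin.
have mpw (D : set R) : measurable_fun D
    (fun t => (poisson r t)%:E * ((ln M)%:E - lne (prodlin C bs t)%:E))%E.
  by apply: emeasurable_funM => //; exact: measurable_poisson.
rewrite -ge0_integralZl_EFin//; last exact: mw.
apply: (@le_trans _ _ (\int[mu]_(t in `[(- d)%R, d])
   ((poisson r t)%:E * ((ln M)%:E - lne (prodlin C bs t)%:E)))%E).
  apply: ge0_le_integral => //.
  - by move=> t _; rewrite mule_ge0// lee_fin.
  - by apply: measurable_funeM; exact: mw.
  - exact: mpw.
  - move=> t; rewrite /= in_itv/= -ler_norml => td.
    have kp : (k%:E <= (poisson r t)%:E)%E by rewrite lee_fin kd.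
    exact: lee_wpmul2r (w0 t) _ _ kp.
apply: ge0_subset_integral => //.
- exact: mpw.
- by move=> t _; rewrite mule_ge0.
- by move=> t; rewrite /= !in_itv/= => /andP[h1 h2]; apply/andP; split; lra.
Qed.

End LogIntegral.

(** * Translations and factorization on the circle *)

Section Translation.
Variable R : realType.
Local Notation mu := (@lebesgue_measure R).

Lemma preimage_addr_itv (c : R) (x y : R) (bx b' : bool) :
  (fun t => t + c) @^-1` [set` Interval (BSide bx (x + c)) (BSide b' (y + c))] =
  [set` Interval (BSide bx x) (BSide b' y)].
Proof.
by apply/seteqP; split => t /=; rewrite !itv_boundlr /=;
  case: bx; case: b'; rewrite !bnd_simp ?lerD2r ?ltrD2r.
Qed.

Lemma ge0_integral_shift (f : R -> \bar R) (a b c : R) :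
  measurable_fun [set: R] f -> (forall t, 0 <= f t)%E ->
  (\int[mu]_(t in `[a, b]) f (t + c)%R = \int[mu]_(t in `[(a + c)%R, (b + c)%R]) f t)%E.
Proof.
move=> mf f0.
have mphi : measurable_fun [set: measurableTypeR R]
    ((fun t : R => t + c) : measurableTypeR R -> measurableTypeR R).
  by apply: continuous_measurable_fun => t; apply: cvgD; [exact: cvg_id|exact: cvg_cst].
rewrite -(preimage_addr_itv c a b true false).
rewrite -(@ge0_integral_pushforward _ _ _ _ R _ mphi _ _ f)//=; last exact: measurable_funS mf.
apply: eq_measure_integral => //= A mA AS.
apply/esym/lebesgue_measure_unique => //= _ [[u v]] _ <-.
rewrite /pushforward.
have -> : (fun t : R => t + c) @^-1` `](u, v).1, (u, v).2]%classic =
    `](u - c), (v - c)]%classic.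
  by have := preimage_addr_itv c (u - c) (v - c) false false; rewrite !subrK.
rewrite !lebesgue_measure_itv/= !lte_fin ltrD2r.
by case: ifP => // _; rewrite -!EFinB; congr EFin; ring.
Qed.

End Translation.

Section Polynomial.
Variable R : realType.
Local Notation mu := (@lebesgue_measure R).
Implicit Types (p : {poly R[i]}).

(** For |z| <= 1, |e^{it} - z| = |1 - z^* e^{it}| on the circle, which reflects a
    zero of the disc to the outside; for |z| > 1, factor out z. *)
Lemma root_circle_factor (z : R[i]) : exists c b,
  [/\ (0 : R) < c, normc b <= 1 & forall t, normc (cis t - z) = c * dist1 b t].
Proof.
have [z1|z1] := leP (normc z) 1.
  exists 1, (conjc z); split; rewrite ?normc_conj// => t.
  rewrite mul1r /dist1 -[LHS]normc_conj rmorphB/=.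
  rewrite -[LHS]mulr1 -(normc_cis t) -ComplexField.Normc.normcM; congr normc.
  rewrite mulrBl; congr (_ - _); rewrite /cis; simpc.
  by rewrite -!expr2 cos2Dsin2; congr (_ +i* _); ring.
have z0 : z != 0 by rewrite -normc_gt0; exact: lt_trans z1.
exists (normc z), z^-1; split; first exact: lt_trans z1.
  by rewrite ComplexField.Normc.normcV invf_le1 ?ltW// (lt_trans _ z1).
move=> t; rewrite /dist1 -ComplexField.Normc.normcM mulrBr mulrA divff// mulr1 mul1r.
by rewrite -normcN opprB.
Qed.

Lemma roots_circle_factor (rs : seq R[i]) : exists C bs,
  [/\ 0 < C, {in bs, forall b, normc b <= 1}, size bs = size rs &
      forall t, \prod_(z <- rs) normc (cis t - z) = prodlin C bs t].
Proof.
elim: rs => [|z rs [C [bs [C0 hb szb E]]]].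
  by exists 1, [::]; split => // t; rewrite /prodlin !big_nil mulr1.
have [c [b [c0 b1 zE]]] := root_circle_factor z.
exists (c * C), (b :: bs); split.
- exact: mulr_gt0.
- by move=> x; rewrite inE => /predU1P[->//|/hb].
- by rewrite /= szb.
- by move=> t; rewrite big_cons zE E /prodlin big_cons; ring.
Qed.

Lemma poly_circle_factor p : p != 0 -> exists C bs,
  [/\ 0 < C, {in bs, forall b, normc b <= 1}, size bs = (size p).-1 &
      forall t, normc p.[cis t] = prodlin C bs t].
Proof.
move=> p0; have [rs pE] := closed_field_poly_normal p.
have lp0 : lead_coef p != 0 by rewrite lead_coef_eq0.
have -> : (size p).-1 = size rs.
  by rewrite pE size_scale// size_prod_XsubC.
have [C [bs [C0 hb szb E]]] := roots_circle_factor rs.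
exists (normc (lead_coef p) * C), bs; split => //.
  by rewrite mulr_gt0// normc_gt0.
move=> t; rewrite /prodlin -mulrA -/(prodlin C bs t) -E.
rewrite {1}pE hornerZ ComplexField.Normc.normcM; congr (_ * _).
rewrite horner_prod; elim: rs {pE szb E} => [|z rs IH].
  by rewrite !big_nil ComplexField.Normc.normc1.
by rewrite !big_cons ComplexField.Normc.normcM IH hornerXsubC.
Qed.

End Polynomial.

(** * The deficit near a large value *)

Section LocalBound.
Variable R : realType.
Local Notation mu := (@lebesgue_measure R).
Implicit Types (p : {poly R[i]}) (C M r t : R) (bs : seq R[i]).

Lemma bernoulli_ineq (x : R) n : 0 <= x <= 1 -> 1 - n%:R * x <= (1 - x) ^+ n.
Proof.
move=> /andP[x0 x1]; elim: n => [|n IH]; first by rewrite mul0r subr0 expr0.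
apply: (@le_trans _ _ ((1 - x) * (1 - n%:R * x))).
  rewrite -natr1; have := ler0n R n; nra.
by rewrite exprS ler_wpM2l// subr_ge0.
Qed.

Lemma prodlin_shift C bs s t :
  prodlin C bs (s + t) = prodlin C [seq b * cis s | b <- bs] t.
Proof.
by rewrite /prodlin big_map; congr (_ * _); apply: eq_bigr => b _; exact: dist1_shift.
Qed.

Lemma prodlin_radial_ge C bs r : 0 < C -> {in bs, forall b, normc b <= 1} ->
  0 <= r <= 1 -> ((1 + r) / 2) ^+ size bs * prodlin C bs 0 <=
  C * \prod_(b <- bs) normc (1 - r%:C * b).
Proof.
move=> C0 hb r01; rewrite /prodlin mulrCA ler_pM2l//.
elim: bs hb => [|b bs IH] hb; first by rewrite !big_nil expr0 mulr1.
have hb' : {in bs, forall b, normc b <= 1}.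
  by move=> c cbs; apply: hb; rewrite inE cbs orbT.
have b1 : normc b <= 1 by apply: hb; rewrite inE eqxx.
rewrite !big_cons exprS mulrACA; apply: ler_pM; last exact: IH.
- by rewrite mulr_ge0 ?dist1_ge0//; lra.
- rewrite mulr_ge0 ?exprn_ge0 ?prodr_ge0//; first lra.
  by move=> c _; exact: dist1_ge0.
- have := dist1_scale_ge 0 b1 r01.
  by rewrite {2}/dist1 cis0 mulr1.
Qed.

Lemma poisson_ge r d t : 0 <= r < 1 -> `|t| <= d -> 1 - r <= d ->
  (1 - r) / (2 * d ^+ 2) <= poisson r t.
Proof.
move=> r01 td rd.
have rc1 : normc r%:C < 1 by rewrite normcr ger0_norm; lra.
have d0 : 0 < d by lra.
have D0 := dist1_gt0 t rc1.
have t2 : t ^+ 2 <= d ^+ 2 by rewrite -[t ^+ 2]real_normK ?num_real// lerXn2r ?nnegrE// ltW.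
have D2 : dist1 r%:C t ^+ 2 <= 2 * d ^+ 2.
  have := dist1_1_le t; rewrite !dist1_sqr ComplexField.Normc.normc1 normcr.
  rewrite real_normK ?num_real// !mul0r !subr0 expr1n /= mul1r => h.
  nra.
rewrite /poisson; apply: ler_pM.
- lra.
- by rewrite invr_ge0 mulr_ge0// sqr_ge0.
- nra.
- by rewrite lef_pV2 ?posrE ?exprn_gt0// mulr_gt0// exprn_gt0.
Qed.

Definition log_deficit M p t : \bar R := ((ln M)%:E - lne (normc p.[cis t])%:E)%E.

Lemma log_deficit_ge0 M p t : normc p.[cis t] <= M -> (0 <= log_deficit M p t)%E.
Proof. by move=> pM; rewrite /log_deficit deficit_ge0// normc_ge0. Qed.

Lemma continuous_normc_horner_cis p : continuous (fun t : R => normc p.[cis t]).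
Proof.
have [->|p0] := eqVneq p 0.
  rewrite (_ : (fun _ => _) = fun=> 0); first by move=> t; exact: cvg_cst.
  by apply/funext => t; rewrite horner0 ComplexField.Normc.normc0.
have [C [bs [_ _ _ E]]] := poly_circle_factor p0.
rewrite (funext E) => t; apply: cvgM; first exact: cvg_cst.
elim: bs {E} => [|b bs IH].
  under eq_fun do rewrite big_nil; rewrite big_nil; exact: cvg_cst.
under eq_fun do rewrite big_cons; rewrite big_cons.
by apply: cvgM => //; exact: continuous_dist1.
Qed.

Lemma measurable_log_deficit M p (D : set R) : measurable_fun D (log_deficit M p).
Proof.
apply: measurable_funTS; apply: emeasurable_funB => //.
apply: measurable_lne_EFin; apply: continuous_measurable_fun.
exact: continuous_normc_horner_cis.
Qed.

(** The inequality of [integral_deficit_local] at radius r = 1 - 1/N: the loss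
    ((1 + r) / 2)^N = (1 - 1/(2N))^N from moving radially into the disc is at
    least 1/2 by Bernoulli, so the Poisson average is at most log (3 * 2), and
    the kernel is at least N / (2 (6 pi)^2) within 6 pi / N. *)
Lemma integral_log_deficit_near M p (N : nat) (tau : R) : p != 0 -> (6 <= N)%N ->
  (size p <= N)%N -> (forall t, normc p.[cis t] <= M) ->
  M <= 3 * normc p.[cis tau] -> 0 < M ->
  (\int[mu]_(t in `[(tau - 6 * pi / N%:R)%R, (tau + 6 * pi / N%:R)%R])
     log_deficit M p t <= (4 * pi * (6 * pi) ^+ 2 * ln 6 / N%:R)%:E)%E.
Proof.
move=> p0 N6 szp pM Mtau M0.
have [C [bs [C0 hb szb E]]] := poly_circle_factor p0.
pose bs' := [seq b * cis tau | b <- bs].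
have hb' : {in bs', forall b, normc b <= 1}.
  move=> _ /mapP[b bbs ->]; rewrite ComplexField.Normc.normcM normc_cis mulr1.
  exact: hb.
have E' t : normc p.[cis (t + tau)] = prodlin C bs' t.
  by rewrite E addrC prodlin_shift.
have FM t : prodlin C bs' t <= M by rewrite -E'.
have N0 : 0 < N%:R :> R by rewrite ltr0n (leq_trans _ N6).
have N6' : 6 <= N%:R :> R by rewrite ler_nat.
pose x : R := N%:R^-1; have x0 : 0 < x by rewrite invr_gt0.
have x6 : x * 6 <= 1 by rewrite mulrC -ler_pdivlMr// div1r invrK.
pose d := 6 * pi * x; have pi2 := pi_ge2 R; have pi0 := pi_gt0 R.
have d0 : 0 < d by rewrite /d !mulr_gt0.
have dpi : d <= pi by rewrite /d; nra.
have xd : x <= d by rewrite /d; nra.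
pose r := 1 - x; have r01 : 0 <= r < 1 by rewrite /r; lra.
have r01' : 0 <= r <= 1 by lra.
have kd t : `|t| <= d -> x / (2 * d ^+ 2) <= poisson r t.
  by move=> td; rewrite {1}(_ : x = 1 - r) ?poisson_ge// /r; lra.
have k0 : 0 < x / (2 * d ^+ 2) by rewrite divr_gt0// mulr_gt0// exprn_gt0.
have := integral_deficit_local C0 hb' FM r01 (ltW k0) dpi kd.
have -> : (\int[mu]_(t in `[(- d)%R, d]) ((ln M)%:E - lne (prodlin C bs' t)%:E) =
    \int[mu]_(t in `[(tau - 6 * pi / N%:R)%R, (tau + 6 * pi / N%:R)%R])
     log_deficit M p t)%E.
  have := @ge0_integral_shift R (log_deficit M p) (- d) d tau
    (@measurable_log_deficit M p setT) (fun t => log_deficit_ge0 (pM t)).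
  rewrite (addrC (- d)) (addrC d) => <-.
  by apply: eq_integral => t _; rewrite /log_deficit E'.
rewrite -lee_pdivlMl// => /le_trans; apply; rewrite -EFinM lee_fin.
have P0 : M / 6 <= C * \prod_(b <- bs') normc (1 - r%:C * b).
  apply: le_trans (prodlin_radial_ge C0 hb' r01').
  rewrite -E' add0r.
  have hh : 2^-1 <= ((1 + r) / 2) ^+ size bs'.
    have -> : (1 + r) / 2 = 1 - x / 2 by rewrite /r; field.
    have x2 : 0 <= x / 2 <= 1 by lra.
    apply: le_trans (bernoulli_ineq _ x2).
    have : (size bs')%:R <= N%:R :> R.
      by rewrite ler_nat size_map szb (leq_trans (leq_pred _)).
    have : N%:R * x = 1 by rewrite divff// gt_eqF.
    nra.
  by apply: le_trans (ler_wpM2r (normc_ge0 _) hh); lra.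
have M6 : 0 < M / 6 by rewrite divr_gt0.
have lnP : ln M - ln (C * \prod_(b <- bs') normc (1 - r%:C * b)) <= ln 6.
  have : ln (M / 6) <= ln (C * \prod_(b <- bs') normc (1 - r%:C * b)).
    by rewrite ler_ln ?posrE// (lt_le_trans M6).
  by rewrite ln_div ?posrE//; lra.
have -> : 4 * pi * (6 * pi) ^+ 2 * ln 6 / N%:R = (x / (2 * d ^+ 2))^-1 * (2 * pi * ln 6).
  have fE (u v w : R) : 0 < u -> 0 < v ->
      4 * v * (6 * v) ^+ 2 * w * u = (u / (2 * (6 * v * u) ^+ 2))^-1 * (2 * v * w).
    by move=> u0 v0; field; rewrite ?gt_eqF.
  exact: fE.
by rewrite ler_pM2l ?invr_gt0// ler_pM2l// mulr_gt0.
Qed.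

End LocalBound.

(** * Discrete Parseval identity and large values *)

Section Parseval.
Variable R : realType.
Implicit Types (th t : R) (G p q : {poly R[i]}).

Lemma sum_even_odd (V : nmodType) (f : nat -> V) n :
  \sum_(0 <= l < n.*2) f l = \sum_(0 <= l < n) (f l.*2 + f l.*2.+1).
Proof.
elim: n => [|n IH]; first by rewrite !big_geq.
by rewrite doubleS !big_nat_recr//= IH addrA.
Qed.

Lemma normc_parallelogram (x y : R[i]) :
  normc (x + y) ^+ 2 + normc (x - y) ^+ 2 = 2 * (normc x ^+ 2 + normc y ^+ 2).
Proof. by rewrite !normcE2; case: x y => a b [c d] /=; ring. Qed.

(** The 2^m-th roots of unity, rotated by th. *)
Definition unroot th m a : R[i] := cis (th + a%:R * (2 * pi / (2 ^ m)%:R)).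

Definition evalc (g : nat -> R[i]) m x := \sum_(0 <= l < 2 ^ m) g l * x ^+ l.

Lemma evalc_split g m x : evalc g m.+1 x =
  evalc (fun l => g l.*2) m (x ^+ 2) + x * evalc (fun l => g l.*2.+1) m (x ^+ 2).
Proof.
rewrite /evalc expnS mul2n sum_even_odd big_split/=; congr (_ + _).
  by apply: eq_bigr => l _; rewrite -exprM mul2n.
by rewrite mulr_sumr; apply: eq_bigr => l _; rewrite -exprM mul2n exprS mulrCA.
Qed.

(** One step of the fast Fourier transform: the points come in pairs x, -x, on
    which g is E(x^2) + x O(x^2) and E(x^2) - x O(x^2), and the squares are the
    2^m-th roots of unity rotated by 2 th. *)
Lemma evalc_parseval g m th :
  \sum_(0 <= a < 2 ^ m) normc (evalc g m (unroot th m a)) ^+ 2 =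
  (2 ^ m)%:R * \sum_(0 <= l < 2 ^ m) normc (g l) ^+ 2.
Proof.
elim: m g th => [|m IH] g th.
  by rewrite expn0 !big_nat1 /evalc expn0 big_nat1 expr0 mulr1 mul1r.
have sq a : unroot th m.+1 a ^+ 2 = unroot (th *+ 2) m a.
  rewrite /unroot -cisM; congr cis; rewrite expnS natrM.
  by field; rewrite pnatr_eq0 expn_eq0.
have opp a : unroot th m.+1 (a + 2 ^ m) = - unroot th m.+1 a.
  rewrite /unroot natrD expnS natrM -[RHS]mulN1r -cis_pi -cisD; congr cis.
  by field; rewrite pnatr_eq0 expn_eq0.
rewrite {1}expnS mul2n -addnn (big_cat_nat (leq0n _) (leq_addr _ _))/=.
rewrite -{2}(add0n (2 ^ m)%N) big_addn addnK -big_split/=.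
under eq_bigr => a _.
  rewrite opp !evalc_split sqrrN sq mulNr normc_parallelogram.
  rewrite ComplexField.Normc.normcM normc_cis mul1r; over.
rewrite -mulr_sumr big_split/= !IH -mulrDr -big_split/=.
by rewrite expnS mul2n sum_even_odd mulrA -mul2n natrM.
Qed.

(** The use below is that the sum over rotated roots of unity is the same for
    every rotation th. *)
Lemma poly_parseval G m th : (size G <= 2 ^ m)%N ->
  \sum_(0 <= a < 2 ^ m) normc G.[unroot th m a] ^+ 2 =
  (2 ^ m)%:R * \sum_(0 <= l < 2 ^ m) normc G`_l ^+ 2.
Proof.
move=> sG; rewrite -(evalc_parseval (fun l => G`_l) m th); apply: eq_bigr => a _.
by rewrite (horner_coef_wide _ sG) /evalc big_mkord.
Qed.

End Parseval.

Section Concentration.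
Variable R : realType.
Implicit Types (th t : R) (G p q : {poly R[i]}).

Definition dirichlet k th : {poly R[i]} := \poly_(l < 2 ^ k) cis (- th) ^+ l.

Lemma size_dirichlet k th : (size (dirichlet k th) <= 2 ^ k)%N.
Proof. exact: size_poly. Qed.

Lemma dirichletE k th t : (dirichlet k th).[cis (th + t)] = \sum_(l < 2 ^ k) cis t ^+ l.
Proof.
rewrite horner_poly; apply: eq_bigr => l _.
by rewrite -exprMn -cisD addrA addNr add0r.
Qed.

Lemma dirichlet_energy k m th s : (k <= m)%N ->
  \sum_(0 <= a < 2 ^ m) normc (dirichlet k th).[unroot s m a] ^+ 2 =
  (2 ^ m)%:R * (2 ^ k)%:R.
Proof.
move=> km; have km2 : (2 ^ k <= 2 ^ m)%N by rewrite leq_exp2l.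
rewrite poly_parseval ?(leq_trans (size_dirichlet _ _))//; congr (_ * _).
rewrite (big_cat_nat (leq0n _) km2)/= [X in _ + X]big1_seq ?addr0.
  rewrite -[RHS]mulr1 mulr_natl -[in RHS](subn0 (2 ^ k)%N) -sumr_const_nat.
  rewrite !big_nat; apply: eq_bigr => l /andP[_ lk].
  by rewrite coef_poly lk normcX normc_cis !expr1n.
move=> l; rewrite mem_index_iota => /= /andP[lk _].
by rewrite coef_poly ltnNge lk ComplexField.Normc.normc0 expr0n.
Qed.

Lemma dirichlet_geom k th t :
  normc (dirichlet k th).[cis (th + t)] * dist1 1 t = dist1 1 ((2 ^ k)%:R * t).
Proof.
rewrite dirichletE /dist1 !mul1r -ComplexField.Normc.normcM.
rewrite mulr_natl cisM -[in RHS]normcN opprB subrX1 mulrC.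
by rewrite -[in LHS]normcN -mulNr opprB.
Qed.

Lemma dirichlet_center k th : normc (dirichlet k th).[cis th] = (2 ^ k)%:R.
Proof.
rewrite -{2}(addr0 th) dirichletE cis0.
under eq_bigr do rewrite expr1n.
by rewrite sumr_const card_ord -(rmorph_nat (real_complex R)) normcr ger0_norm.
Qed.

Lemma dist1_1_sqr t : dist1 1 t ^+ 2 = 2 - 2 * cos t.
Proof.
by rewrite dist1_sqr ComplexField.Normc.normc1 /= mul0r subr0 mul1r; ring.
Qed.

(** By the geometric sum, |D| |1 - e^{it}| = |1 - e^{i 2^k t}|, and |1 - e^{it}| <= |t|. *)
Lemma dirichlet_near k th t c : `|t| <= c / (2 ^ k)%:R -> 0 < c ->
  dist1 1 ((2 ^ k)%:R * t) ^+ 2 * ((2 ^ k)%:R / c) ^+ 2 <=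
  normc (dirichlet k th).[cis (th + t)] ^+ 2.
Proof.
move=> tc c0; set q : R := (2 ^ k)%:R; rewrite -/q in tc.
have q0 : 0 < q by rewrite ltr0n expn_gt0.
rewrite -(dirichlet_geom k th) exprMn.
have t2 : t ^+ 2 <= (c / q) ^+ 2.
  by rewrite -[t ^+ 2]real_normK ?num_real// lerXn2r ?nnegrE// divr_ge0// ltW.
have d2 := le_trans (dist1_1_le t) t2.
rewrite -[leRHS]mulr1 -mulrA; apply: ler_wpM2l; first exact: sqr_ge0.
apply: le_trans (ler_wpM2r (sqr_ge0 (q / c)) d2) _.
rewrite -exprMn (_ : c / q * (q / c) = 1) ?expr1n//.
by field; rewrite !gt_eqF.
Qed.

(** With Q = 2^k and D the Dirichlet kernel centred at the middle point (a = 2),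
    the weights |D|^2 have sum 4 Q^2 over all 4 Q roots of unity, the sum of
    |D|^2 F is 16 Q^3, and the five weights are at least Q^2 times
    1/4, 1/2, 1, 1/2, 1/4.  If F < Q at all five points then, as F <= 8 Q, the
    sum of |D|^2 (8 Q - F), which is 16 Q^3, would be at least
    (5/2) Q^2 * 7 Q = (35/2) Q^3. *)
Lemma exists_large_among_five k p q (F : R[i] -> R) th : (1 <= k)%N ->
  (size p <= 2 ^ k)%N -> (size q <= 2 ^ k)%N ->
  (forall t, normc p.[cis t] ^+ 2 + normc q.[cis t] ^+ 2 = 2 * (2 ^ k)%:R) ->
  (forall a, F (unroot th k.+2 a) =
     4 * normc (if odd a then q else p).[unroot th k.+2 a] ^+ 2) ->
  exists2 a, (a < 5)%N & (2 ^ k)%:R <= F (unroot th k.+2 a).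
Proof.
move=> k1 sp sq pq FE.
set Q : R := (2 ^ k)%:R in pq *.
have Q0 : 0 < Q by rewrite ltr0n expn_gt0.
pose al : R := 2 * pi / (2 ^ k.+2)%:R.
have QalE : Q * al = pi / 2.
  by rewrite /al !expnS !natrM -/Q; field; rewrite gt_eqF.
have pi4 : pi <= 4 :> R by have := @pihalf_lt2 R; lra.
have pi0 := pi_gt0 R.
have al0 : 0 < al by rewrite /al divr_gt0 ?mulr_gt0// ltr0n expn_gt0.
have al2 : al <= 2 / Q.
  by rewrite ler_pdivlMr// mulrC QalE; lra.
pose c := th + 2%:R * al.
pose D := dirichlet k c.
pose z a := unroot th k.+2 a.
pose d a := normc D.[z a] ^+ 2.
have zE a : z a = cis (c + (a%:R - 2%:R) * al).
  by rewrite /z /unroot -/al /c; congr cis; ring.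
(* lower bounds for the five weights; pi <= 4 bounds the step by 2 / Q *)
have d_2 : d 2 = Q ^+ 2.
  by rewrite /d zE subrr mul0r addr0 dirichlet_center.
have near a j : (a%:R - 2%:R : R) = j -> `|j| <= 2 -> j != 0 ->
    (2 - 2 * cos (j * (pi / 2))) * (Q / (2 * `|j|)) ^+ 2 <= d a.
  move=> aj j2 j0; rewrite /d zE aj -QalE [j * (Q * al)]mulrCA -dist1_1_sqr.
  apply: dirichlet_near; last by rewrite mulr_gt0// normr_gt0.
  rewrite normrM (gtr0_norm al0) [2 * _]mulrC -mulrA ler_wpM2l//.
have cp1 : cos (1 * (pi / 2)) = 0 :> R by rewrite mul1r cos_pihalf.
have cp2 : cos (2 * (pi / 2)) = -1 :> R by rewrite mulrC divfK ?cospi.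
have d_1 : Q ^+ 2 / 2 <= d 1.
  have := @near 1%N (-1) _ _ _; rewrite mulNr cosN cp1 normrN normr1.
  move=> H; apply: le_trans (H _ _ _); [|by ring|by lra|by rewrite oppr_eq0 oner_eq0].
  by rewrite le_eqVlt; apply/orP; left; apply/eqP; field.
have d_3 : Q ^+ 2 / 2 <= d 3.
  have := @near 3%N 1 _ _ _; rewrite cp1 normr1.
  move=> H; apply: le_trans (H _ _ _); [|by ring|by lra|by rewrite oner_eq0].
  by rewrite le_eqVlt; apply/orP; left; apply/eqP; field.
have n2 : `|2| = 2 :> R by rewrite ger0_norm.
have d_0 : Q ^+ 2 / 4 <= d 0%N.
  have := @near 0%N (-2) _ _ _; rewrite mulNr cosN cp2 normrN n2.
  move=> H; apply: le_trans (H _ _ _); [|by ring|by lra|by rewrite oppr_eq0 pnatr_eq0].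
  by rewrite le_eqVlt; apply/orP; left; apply/eqP; field.
have d_4 : Q ^+ 2 / 4 <= d 4.
  have := @near 4%N 2 _ _ _; rewrite cp2 n2.
  move=> H; apply: le_trans (H _ _ _); [|by ring|by lra|by rewrite pnatr_eq0].
  by rewrite le_eqVlt; apply/orP; left; apply/eqP; field.
have sumd : \sum_(0 <= a < 2 ^ k.+2) d a = 4 * Q ^+ 2.
  rewrite /d /z dirichlet_energy; last by rewrite ltnW// ltnW.
  by rewrite !expnS !natrM -/Q; ring.
have ev a : z a.*2 = unroot th k.+1 a.
  rewrite /z /unroot; congr cis; congr (_ + _).
  by rewrite -mul2n [(2 ^ k.+2)%N]expnS !natrM; field; rewrite pnatr_eq0 expn_eq0.
have od a : z a.*2.+1 = unroot (th + al) k.+1 a.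
  rewrite /z /unroot /al; congr cis; rewrite -addrA; congr (_ + _).
  rewrite -mul2n -natr1 [(2 ^ k.+2)%N]expnS !natrM; field.
  by rewrite pnatr_eq0 expn_eq0.
have sizeD G : (size G <= 2 ^ k)%N -> (size (D * G)%R <= 2 ^ k.+1)%N.
  move=> sG; apply: leq_trans (size_polyMleq _ _) _.
  apply: leq_trans (leq_pred _) _.
  by rewrite expnS mul2n -addnn leq_add// size_dirichlet.
have sumdF : \sum_(0 <= a < 2 ^ k.+2) d a * F (z a) = 16 * Q ^+ 3.
  rewrite expnS mul2n sum_even_odd big_split/=.
  have -> : \sum_(0 <= a < 2 ^ k.+1) d a.*2.+1 * F (z a.*2.+1) =
      4 * \sum_(0 <= a < 2 ^ k.+1) normc (D * q).[unroot (th + al) k.+1 a] ^+ 2.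
    rewrite mulr_sumr; apply: eq_bigr => a _.
    rewrite /z FE /= odd_double /= -/(z _) /d od hornerM.
    by rewrite ComplexField.Normc.normcM; ring.
  (* move the odd points back to the even ones, where |p|^2 + |q|^2 is known *)
  rewrite (poly_parseval _ (sizeD _ sq)) -(poly_parseval th (sizeD _ sq)).
  rewrite mulr_sumr -big_split/=.
  transitivity (\sum_(0 <= a < 2 ^ k.+1) 8 * Q * normc D.[unroot th k.+1 a] ^+ 2).
    apply: eq_bigr => a _; rewrite /z FE odd_double /=.
    rewrite -/(z _) /d ev hornerM.
    rewrite ComplexField.Normc.normcM.
    have := pq (th + a%:R * (2 * pi / (2 ^ k.+1)%:R)); rewrite -/(unroot th k.+1 a).
    move: (normc q.[_]) (normc p.[_]) (normc D.[_]) => u v w uv.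
    transitivity (4 * w ^+ 2 * (v ^+ 2 + u ^+ 2)); first by ring.
    by rewrite uv; ring.
  rewrite -mulr_sumr dirichlet_energy// !expnS !natrM -/Q; ring.
have Fle a : F (z a) <= 8 * Q.
  rewrite /z FE; have := pq (th + a%:R * (2 * pi / (2 ^ k.+2)%:R)).
  rewrite -/(unroot th k.+2 a).
  have := sqr_ge0 (normc p.[unroot th k.+2 a]).
  have := sqr_ge0 (normc q.[unroot th k.+2 a]).
  by case: ifP => _; lra.
have [a5|H] := pselect (exists2 a, (a < 5)%N & Q <= F (z a)); first exact: a5.
exfalso.
have Flt a : (a < 5)%N -> F (z a) <= Q.
  by move=> a5; rewrite leNgt; apply/negP => h; apply: H; exists a => //; exact: ltW.
have k5 : (5 <= 2 ^ k.+2)%N by rewrite (@leq_trans (2 ^ 3))// leq_exp2l.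
have gap0 a : 0 <= d a * (8 * Q - F (z a)).
  by rewrite mulr_ge0 ?sqr_ge0// subr_ge0.
have gapE : \sum_(0 <= a < 2 ^ k.+2) d a * (8 * Q - F (z a)) = 16 * Q ^+ 3.
  under eq_bigr do rewrite mulrBr.
  by rewrite sumrB sumdF -mulr_suml sumd; ring.
have : \sum_(0 <= a < 5) d a * (8 * Q - F (z a)) <= 16 * Q ^+ 3.
  by rewrite -gapE (big_cat_nat (leq0n _) k5)/= lerDl sumr_ge0.
have : \sum_(0 <= a < 5) d a * (7 * Q) <= \sum_(0 <= a < 5) d a * (8 * Q - F (z a)).
  rewrite big_nat [leRHS]big_nat; apply: ler_sum => a /andP[_ a5].
  by rewrite ler_wpM2l ?sqr_ge0//; have := Flt a a5; lra.
have -> : \sum_(0 <= a < 5) d a * (7 * Q) = (d 0%N + d 1%N + d 2%N + d 3%N + d 4%N) * (7 * Q).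
  by rewrite -mulr_suml 5?big_ltn// big_geq// addr0 !addrA.
rewrite d_2 => h1 h2.
have h3 : (Q ^+ 2 * (5 / 2)) * (7 * Q) <= 16 * Q ^+ 3.
  apply: le_trans h2; apply: le_trans h1; apply: ler_wpM2r; first lra.
  lra.
have Q3 : 0 < Q ^+ 3 by rewrite exprn_gt0.
have : (Q ^+ 2 * (5 / 2)) * (7 * Q) = Q ^+ 3 * (35 / 2) by field.
lra.
Qed.

End Concentration.

(** * Rudin-Shapiro polynomials and coverings *)

Section RudinShapiro.
Variable R : realType.
Local Notation mu := (@lebesgue_measure R).
Local Notation P := (rudin_shapiroP R[i]).
Local Notation Q := (rudin_shapiroQ R[i]).
Implicit Types (t x th : R) (p : {poly R[i]}).

Lemma rudin_shapiro_energy n t :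
  normc (P n).[cis t] ^+ 2 + normc (Q n).[cis t] ^+ 2 = 2 * (2 ^ n)%:R.
Proof.
elim: n => [|n IH].
  by rewrite /= !hornerC ComplexField.Normc.normc1 expr1n mulr1.
rewrite [P _]/= [Q _]/= !(hornerE, hornerXn).
rewrite normc_parallelogram ComplexField.Normc.normcM normcX.
by rewrite normc_cis expr1n mul1r IH expnS natrM.
Qed.

Lemma rudin_shapiro_le n t :
  normc (P n).[cis t] <= Num.sqrt (2 * (2 ^ n)%:R) /\
  normc (Q n).[cis t] <= Num.sqrt (2 * (2 ^ n)%:R).
Proof.
have := rudin_shapiro_energy n t => E.
split; rewrite -[leLHS]ger0_norm ?normc_ge0// -sqrtr_sqr ler_wsqrtr// -E.
  by rewrite lerDl sqr_ge0.
by rewrite lerDr sqr_ge0.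
Qed.

(** With w = z^(2^n), P_(n+2) = P_n + w Q_n + w^2 (P_n - w Q_n) and Q_(n+2) has the
    opposite sign in front of w^2, so w^2 = 1 or -1 leaves only one of P_n, Q_n. *)
Lemma rudin_shapiro2 n z : z ^+ (2 ^ n.+1) = 1 \/ z ^+ (2 ^ n.+1) = -1 ->
  normc z = 1 ->
  normc (P n.+2).[z] ^+ 2 =
    4 * normc (if z ^+ (2 ^ n.+1) == 1 then P n else Q n).[z] ^+ 2 /\
  normc (Q n.+2).[z] ^+ 2 =
    4 * normc (if z ^+ (2 ^ n.+1) == 1 then Q n else P n).[z] ^+ 2.
Proof.
move=> zz z1.
have E2 (y : R[i]) : normc (y + y) ^+ 2 = 4 * normc y ^+ 2.
  by rewrite -mulr2n normcMn; move: (normc y) => u; ring.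
have m11 : (-1 == 1 :> R[i]) = false.
  by apply/negP => /eqP/(congr1 (@complex.Re _)) /= ; lra.
have -> : (P n.+2).[z] = (P n).[z] + z ^+ (2 ^ n) * (Q n).[z] +
    z ^+ (2 ^ n.+1) * ((P n).[z] - z ^+ (2 ^ n) * (Q n).[z]).
  by rewrite /= !(hornerE, hornerXn).
have -> : (Q n.+2).[z] = (P n).[z] + z ^+ (2 ^ n) * (Q n).[z] -
    z ^+ (2 ^ n.+1) * ((P n).[z] - z ^+ (2 ^ n) * (Q n).[z]).
  by rewrite /= !(hornerE, hornerXn).
have w1 (y : R[i]) : normc (z ^+ (2 ^ n) * y) = normc y.
  by rewrite ComplexField.Normc.normcM normcX z1 expr1n mul1r.
set w := z ^+ (2 ^ n) in w1 *.
case: zz => ->; rewrite ?eqxx ?m11.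
  split; first by rewrite -E2; congr (normc _ ^+ 2); ring.
  by rewrite -[in RHS](w1 (Q n).[z]) -E2; congr (normc _ ^+ 2); ring.
split; last by rewrite -E2; congr (normc _ ^+ 2); ring.
by rewrite -[in RHS](w1 (Q n).[z]) -E2; congr (normc _ ^+ 2); ring.
Qed.

Lemma cis_nat_pi n : cis (n%:R * pi : R) = (-1) ^+ n.
Proof. by rewrite mulr_natl cisM cis_pi. Qed.

Lemma signC_cases n : (-1 : R[i]) ^+ n = 1 \/ (-1 : R[i]) ^+ n = -1.
Proof. by rewrite -signr_odd; case: (odd n); [right|left]. Qed.

Lemma cis_int_pi (c : int) : cis (c%:~R * pi : R) = 1 \/ cis (c%:~R * pi : R) = -1.
Proof.
have cisN s : cis (- s : R) = conjc (cis s) by rewrite /cis cosN sinN.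
case: c => n; first by rewrite cis_nat_pi; exact: signC_cases.
rewrite NegzE rmorphN /= mulNr cisN cis_nat_pi.
by case: (signC_cases n.+1) => ->; rewrite ?rmorphN rmorph1; [left|right].
Qed.

(** The roots of unity of order 2^(k+2) have step h; five consecutive ones are taken
    starting between x - 2 h and x - h. *)
Lemma rudin_shapiro_large k x (G : {poly R[i]}) : (1 <= k)%N ->
  G = P k.+2 \/ G = Q k.+2 ->
  let h := 2 * pi / (2 ^ k.+2)%:R in
  exists2 tau, x - 2 * h <= tau <= x + 3 * h &
    (2 ^ k)%:R <= normc G.[cis tau] ^+ 2.
Proof.
move=> k1 GPQ h; have pi0 := pi_gt0 R.
have h0 : 0 < h by rewrite divr_gt0 ?mulr_gt0// ltr0n expn_gt0.
pose c := Num.floor ((x - h) / h); pose th := c%:~R * h.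
have c1 : th <= x - h by rewrite -ler_pdivlMr// floor_le_tmp.
have c2 : x - h < th + h.
  by have := floorD1_gt ((x - h) / h); rewrite ltr_pdivrMr// intrD mulrDl mul1r.
have root a : unroot th k.+2 a ^+ (2 ^ k.+1) = cis (c%:~R * pi) * (-1) ^+ a.
  rewrite /unroot -cisM -cis_nat_pi -cisD; congr cis.
  rewrite -mulr_natr /th /h (expnS 2 k.+1) natrM; field.
  by rewrite pnatr_eq0 expn_eq0.
have sgn a : unroot th k.+2 a ^+ (2 ^ k.+1) = 1 \/ unroot th k.+2 a ^+ (2 ^ k.+1) = -1.
  rewrite root; case: (cis_int_pi c) => ->; case: (signC_cases a) => ->;
    rewrite ?mulrNN ?mulrN ?mulr1; by [left|right].
have n1 a : normc (unroot th k.+2 a) = 1 by exact: normc_cis.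
have m11 : (-1 == 1 :> R[i]) = false.
  by apply/negP => /eqP/(congr1 (@complex.Re _)) /= ; lra.
have [sP sQ] := size_rudin_shapiro R[i] k.
have en1 := @rudin_shapiro_energy k.
have en2 t : normc (Q k).[cis t] ^+ 2 + normc (P k).[cis t] ^+ 2 = 2 * (2 ^ k)%:R.
  by rewrite addrC en1.
have large : exists2 a, (a < 5)%N & (2 ^ k)%:R <= normc G.[unroot th k.+2 a] ^+ 2.
  case: (cis_int_pi c) => e; case: GPQ => ->.
  - apply: (@exists_large_among_five R k (P k) (Q k)
      (fun z => normc (P k.+2).[z] ^+ 2)); rewrite ?sP ?sQ// => a.
    rewrite (rudin_shapiro2 (sgn a) (n1 a)).1 root e mul1r -signr_odd.
    by case: (odd a); rewrite ?expr1 ?expr0 ?m11 ?eqxx.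
  - apply: (@exists_large_among_five R k (Q k) (P k)
      (fun z => normc (Q k.+2).[z] ^+ 2)); rewrite ?sP ?sQ// => a.
    rewrite (rudin_shapiro2 (sgn a) (n1 a)).2 root e mul1r -signr_odd.
    by case: (odd a); rewrite ?expr1 ?expr0 ?m11 ?eqxx.
  - apply: (@exists_large_among_five R k (Q k) (P k)
      (fun z => normc (P k.+2).[z] ^+ 2)); rewrite ?sP ?sQ// => a.
    rewrite (rudin_shapiro2 (sgn a) (n1 a)).1 root e mulN1r -signr_odd.
    by case: (odd a); rewrite ?expr1 ?expr0 ?opprK ?m11 ?eqxx.
  - apply: (@exists_large_among_five R k (P k) (Q k)
      (fun z => normc (Q k.+2).[z] ^+ 2)); rewrite ?sP ?sQ// => a.
    rewrite (rudin_shapiro2 (sgn a) (n1 a)).2 root e mulN1r -signr_odd.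
    by case: (odd a); rewrite ?expr1 ?expr0 ?opprK ?m11 ?eqxx.
have [a a5 Ga] := large.
exists (th + a%:R * h) => //.
have a4 : a%:R <= 4 :> R by rewrite ler_nat -ltnS.
have a0 : 0 <= a%:R :> R by [].
by apply/andP; split; nra.
Qed.

End RudinShapiro.

Section Covering.
Variable R : realType.
Local Notation mu := (@lebesgue_measure R).
Implicit Types (g : R -> \bar R) (a b c h K : R).

Lemma ge0_integral_itv_subadd g a b c : measurable_fun [set: R] g ->
  (forall t, 0 <= g t)%E -> a <= b -> b <= c ->
  (\int[mu]_(t in `[a, c]) g t <=
   \int[mu]_(t in `[a, b]) g t + \int[mu]_(t in `[b, c]) g t)%E.
Proof.
move=> mg g0 ab bc.
have -> : `[a, c]%classic = `[a, b]%classic `|` `]b, c]%classic :> set R.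
  by rewrite -itv_bndbnd_setU ?bnd_simp.
rewrite ge0_integral_setU//=.
- apply: leeD2l; apply: ge0_subset_integral => //; first exact: measurable_funS mg.
  by apply: subset_itvr; rewrite bnd_simp.
- exact: measurable_funS mg.
- by apply/disj_setPRL => t /=; rewrite !in_itv/= => /andP[bt _] /andP[_ tb]; lra.
Qed.

(** The number of arcs of length h needed is at most (b - a) / h + 1 <= 2 (b - a) / h. *)
Lemma ge0_integral_cover g h K : measurable_fun [set: R] g ->
  (forall t, 0 <= g t)%E -> 0 < h ->
  (forall x, \int[mu]_(t in `[x, (x + h)%R]) g t <= (h * K)%:E)%E ->
  forall a b, h <= b - a -> (\int[mu]_(t in `[a, b]) g t <= (2 * (b - a) * K)%:E)%E.
Proof.
move=> mg g0 h0 gK a b hab.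
have K0 : 0 <= K.
  rewrite -(pmulr_rge0 _ h0) -lee_fin; apply: le_trans (gK 0).
  exact: integral_ge0.
have step m : (\int[mu]_(t in `[a, (a + m.+1%:R * h)%R]) g t <= (m.+1%:R * h * K)%:E)%E.
  elim: m => [|m IH]; first by rewrite !mul1r.
  have m0 : 0 <= m.+1%:R :> R by [].
  apply: le_trans (@ge0_integral_itv_subadd g a (a + m.+1%:R * h) _ mg g0 _ _) _.
  - by rewrite lerDl mulr_ge0// ltW.
  - by rewrite lerD2l ler_pM2r// ler_nat.
  - have -> : a + m.+2%:R * h = a + m.+1%:R * h + h by rewrite -[m.+2%:R]natr1; ring.
    apply: le_trans (leeD IH (gK _)) _.
    rewrite -EFinD lee_fin -[m.+2%:R]natr1.
    by rewrite le_eqVlt; apply/orP; left; apply/eqP; ring.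
pose m := Num.truncn ((b - a) / h).
have q0 : 0 <= (b - a) / h by rewrite divr_ge0 ?(ltW h0)//; lra.
have /andP[m1 m2] : m%:R <= (b - a) / h < m.+1%:R by exact: truncn_itv.
rewrite ler_pdivlMr// in m1; rewrite ltr_pdivrMr// in m2.
apply: (@le_trans _ _ (\int[mu]_(t in `[a, (a + m.+1%:R * h)%R]) g t)%E).
  apply: ge0_subset_integral => //; first exact: measurable_funS mg.
  by apply: subset_itvl; rewrite bnd_simp; lra.
apply: le_trans (step m) _; rewrite lee_fin ler_wpM2r//.
rewrite -natr1; lra.
Qed.

End Covering.

(** * Mahler measure on an arc *)

Section Final.
Variable R : realType.
Local Notation mu := (@lebesgue_measure R).
Implicit Types (p : {poly R[i]}) (M a b K : R).

(** The deficit has a finite integral, so log |p| = log M - deficit may be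
    integrated termwise although it takes the value -oo at the zeros. *)
Lemma mahler_measure_ge p M a b K : 0 < M -> (forall t, normc p.[cis t] <= M) ->
  a < b -> (\int[mu]_(t in `[a, b]) log_deficit M p t <= ((b - a) * K)%:E)%E ->
  ((M * expR (- K))%:E <= mahler_measure p a b)%E.
Proof.
move=> M0 pM ab IK; rewrite /mahler_measure.
have ba0 : 0 < b - a by rewrite subr_gt0.
set I := integral _ _ _ in IK.
have I0 : (0 <= I)%E by apply: integral_ge0 => t _; exact: log_deficit_ge0.
have Ifin : I \is a fin_num.
  by rewrite ge0_fin_numE// (le_lt_trans IK)// ltry.
have ic : mu.-integrable `[a, b] (cst (ln M)%:E).
  by apply: continuous_integrable_itv => x; exact: cvg_cst.
have ig : mu.-integrable `[a, b] (log_deficit M p).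
  apply/integrableP; split; first exact: measurable_log_deficit.
  have -> : (\int[mu]_(t in `[a, b]) `|log_deficit M p t| = I)%E.
    by apply: eq_integral => t _; rewrite gee0_abs// log_deficit_ge0.
  by rewrite ltey_eq Ifin.
have -> : (\int[mu]_(t in `[a, b]) lne (normc p.[cis t])%:E =
    ((b - a) * ln M)%:E - I)%E.
  transitivity (\int[mu]_(t in `[a, b]) (cst (ln M)%:E \- log_deficit M p) t)%E.
    apply: eq_integral => t _; rewrite /log_deficit.
    case: (lne (normc p.[cis t])%:E) => [r| |] //=.
    by rewrite -!EFinB; congr EFin; ring.
  rewrite integralB//; congr (_ - _)%E.
  rewrite integral_cst//= lebesgue_measure_itv/= lte_fin ab -EFinB -EFinM.
  by rewrite mulrC.
rewrite -{1}(lnK M0 : expR _ = _) -expRD -[(expR _)%:E]/(expeR (_)%:E) lee_expeR.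
move: IK; rewrite lee_pdivlMl// -(fineK Ifin) -EFinB -EFinM !lee_fin.
move=> IK; lra.
Qed.

End Final.

Theorem theorem2p3 (R : realType) :
  exists c2 : R, 0 < c2 /\
    forall (n : nat) (alpha beta : R),
      let N : R := (2 ^ n)%:R in
      32 * pi / N <= (ln N `^ (3 / 2)) / (N `^ (1 / 2)) ->
      (ln N `^ (3 / 2)) / (N `^ (1 / 2)) <= beta - alpha ->
      beta - alpha <= 2 * pi ->
      ((c2 * Num.sqrt N)%:E <= mahler_measure (rudin_shapiroP R[i] n) alpha beta)%E /\
      ((c2 * Num.sqrt N)%:E <= mahler_measure (rudin_shapiroQ R[i] n) alpha beta)%E.
Proof.
(* h K is the bound of [integral_log_deficit_near], with h = 2 pi / N *)
pose K : R := 2 * (6 * pi) ^+ 2 * ln 6.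
exists (expR (- (2 * K))); split; first exact: expR_gt0.
move=> n a b N h1 h2 h3; have pi0 := pi_gt0 R.
have N0 : 0 < N by rewrite ltr0n expn_gt0.
have hab : 32 * pi / N <= b - a := le_trans h1 h2.
have N16 : 16 <= N.
  have : 32 * pi / N <= 2 * pi := le_trans hab h3.
  by rewrite ler_pdivrMr//; nra.
have [k k1 nE] : exists2 k, (1 <= k)%N & n = k.+2.
  move: N16; rewrite /N; case: n {N h1 h2 N0 hab} => [|[|[|n]]]; rewrite ?ler_nat//.
  by exists n.+1.
have Nk : N = 4 * (2 ^ k)%:R by rewrite /N nE !expnS !natrM mulrA -natrM.
pose M := Num.sqrt (2 * N).
have M0 : 0 < M by rewrite sqrtr_gt0 mulr_gt0.
pose h := 2 * pi / N.
have h0 : 0 < h by rewrite divr_gt0// mulr_gt0.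
have ln6 : 0 <= ln (6 : R) by rewrite ln_ge0// ler1n.
suff main G : G = rudin_shapiroP R[i] n \/ G = rudin_shapiroQ R[i] n ->
    ((expR (- (2 * K)) * Num.sqrt N)%:E <= mahler_measure G a b)%E.
  by split; apply: main; [left|right].
move=> GPQ.
have [sP sQ] := size_rudin_shapiro R[i] n.
have sG : size G = (2 ^ n)%N by case: GPQ => ->.
have G0 : G != 0 by rewrite -size_poly_gt0 sG expn_gt0.
have GM t : normc G.[cis t] <= M.
  by have [hP hQ] := rudin_shapiro_le n t; case: GPQ => ->.
have win x : (\int[lebesgue_measure]_(t in `[x, (x + h)%R]) log_deficit M G t <=
    (h * K)%:E)%E.
  have GPQ' : G = rudin_shapiroP R[i] k.+2 \/ G = rudin_shapiroQ R[i] k.+2.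
    by rewrite -nE.
  have [tau] := rudin_shapiro_large x k1 GPQ'.
  rewrite -nE -/N -/h => /andP[tau1 tau2] Gtau.
  have Mtau : M <= 3 * normc G.[cis tau].
    rewrite -(@ler_pXn2r _ 2)// ?nnegrE ?mulr_ge0 ?normc_ge0 ?(ltW M0)//.
    rewrite exprMn sqr_sqrtr ?mulr_ge0 ?(ltW N0)//.
    by rewrite Nk; have : 0 <= (2 ^ k)%:R :> R by []; lra.
  have N6 : (6 <= 2 ^ n)%N by rewrite -(ler_nat R) -/N; lra.
  have := @integral_log_deficit_near R M G (2 ^ n) tau G0 N6 _ GM Mtau M0.
  rewrite sG leqnn -/N => /(_ isT) H.
  have -> : (h * K)%:E = (4 * pi * (6 * pi) ^+ 2 * ln 6 / N)%:E.
    by congr EFin; rewrite /h /K; field; rewrite gt_eqF.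
  (* x - 2 h <= tau <= x + 3 h puts [x, x + h] within 3 h = 6 pi / N of tau *)
  apply: le_trans H; apply: ge0_subset_integral => //.
  - exact: measurable_log_deficit.
  - by move=> t _; exact: log_deficit_ge0.
  - have e : 6 * pi / N = 3 * h by rewrite /h; field; rewrite gt_eqF.
    move=> t; rewrite /= !in_itv/= e => /andP[t1 t2].
    by apply/andP; split; lra.
have hba : h <= b - a.
  apply: le_trans hab; rewrite /h ler_pM2r ?invr_gt0//; lra.
have ab : a < b by rewrite -subr_gt0; exact: lt_le_trans hba.
have H := ge0_integral_cover (@measurable_log_deficit R M G setT)
  (fun t => log_deficit_ge0 (GM t)) h0 win hba.
have := @mahler_measure_ge R G M a b (2 * K) M0 GM ab.
have -> : (b - a) * (2 * K) = 2 * (b - a) * K by ring.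
move=> /(_ H); apply: le_trans.
rewrite lee_fin mulrC ler_pM2r ?expR_gt0// ler_wsqrtr//; lra.
Qed.
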